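(* Let $\mu$ be a positive Borel measure on $(0,\infty)$ satisfying $\mu((0,1])=0$, let $\phi\in\mathcal{C}$, and let $1\leq p,q\leq\infty$. Then the Hausdorff operator $\mathcal{H}_\mu$ is uniformly mean ergodic on $F_\phi^{p,q}$ if and only if $$\int_{(1,\infty)}\frac{1}{t}\,d\mu(t)\leq 1.$$
   Context: $H(\mathbb{C})$ denotes the space of entire functions. Let $\phi:[0,\infty)\to\mathbb{R}^+$ be continuously differentiable, extended radially to $\mathbb{C}$ by $\phi(z)=\phi(|z|)$. It is called a weight if $\int_0^\infty e^{-q\phi(r)}r\,dr<\infty$ for the exponent $q$ under consideration, $0<q<\infty$ (when the space considered has $q=\infty$, the integral condition is understood for some finite exponent). A weight $\phi$ belongs to the class $\mathcal{C}$ if $\lim_{r\to\infty}r\phi'(r)=\infty$. For $f\in H(\mathbb{C})$ and $0\le r<\infty$ let $M_p(f,r)=\left(\frac{1}{2\pi}\int_0^{2\pi}|f(re^{i\theta})|^p\,d\theta\right)^{1/p}$ for $0<p<\infty$ and $M_\infty(f,r)=\sup_{|z|=r}|f(z)|$. For $0<p\le\infty$, the weighted mixed norm Fock space $F_\phi^{p,q}$ consists of all $f\in H(\mathbb{C})$ with $\|f\|_{p,q,\phi}<\infty$, where $\|f\|_{p,q,\phi}^q=\int_0^\infty M_p^q(f,r)e^{-q\phi(r)}r\,dr$ if $0<q<\infty$, and $\|f\|_{p,\infty,\phi}=\sup_{r\in[0,\infty)}M_p(f,r)e^{-\phi(r)}$ if $q=\infty$. For $1\le p,q\le\infty$ it is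 a Banach space. For a positive Borel measure $\mu$ on $(0,\infty)$, the Hausdorff operator is defined formally by $\mathcal{H}_\mu f(z)=\int_{(0,\infty)}\frac{1}{t}f\left(\frac{z}{t}\right)d\mu(t)$, $z\in\mathbb{C}$, for $f\in H(\mathbb{C})$. It is bounded on $F_\phi^{p,q}$ if this formula defines a bounded linear operator from $F_\phi^{p,q}$ to itself. For a bounded linear operator $T$ on a Banach space $X$ the Cesàro means are $T_{[n]}=\frac{1}{n}\sum_{k=1}^nT^k$, $n\in\mathbb{N}$. A bounded linear operator $T$ on $X$ is uniformly mean ergodic if there is a bounded linear operator $P$ on $X$ with $T_{[n]}\to P$ in operator norm as $n\to\infty$. *)

(* Defs.v *)
From HB Require Import structures.
From mathcomp Require Import all_boot all_order all_algebra.
From mathcomp Require Import all_classical all_reals all_analysis.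
From mathcomp Require Import complex.

Set Implicit Arguments.
Unset Strict Implicit.
Unset Printing Implicit Defensive.

Import Order.TTheory GRing.Theory Num.Theory.
Import numFieldNormedType.Exports.
Import ComplexField.Normc.

Local Open Scope classical_set_scope.
Local Open Scope complex_scope.
Local Open Scope ring_scope.

(* The Banach space X is a linear subspace (a set X of vectors) of an ambient
   K-vector space V, with norm N : V -> \bar R finite on X; operators on X are
   maps V -> V, of which only the values on X matter. *)
Section Operators.
Context {R : realType} {K : numFieldType} {V : lmodType K}.
Implicit Types (X : set V) (N : V -> \bar R) (T P : V -> V).

Definition bounded_linear X N T : Prop :=
  [/\ forall x, X x -> X (T x),
      forall (a : K) x y, X x -> X y -> T (a *: x + y) = a *: T x + T y
    & exists M : R, forall x, X x -> (N (T x) <= M%:E * N x)%E].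

Definition opnorm X N T : \bar R :=
  ereal_sup [set N (T x) | x in [set x | X x /\ (N x <= 1)%E]].

Definition cesaro_mean T (n : nat) : V -> V :=
  fun x => n%:R^-1 *: \sum_(1 <= k < n.+1) iter k T x.

Definition uniformly_mean_ergodic X N T : Prop :=
  bounded_linear X N T /\
  exists P, bounded_linear X N P /\
    opnorm X N (fun x => cesaro_mean T n x - P x) @[n --> \oo] --> 0%E.

End Operators.

Section Fock.
Context {R : realType}.
Implicit Types (phi : R -> R) (p q : \bar R).

(* Weights live on [0, +oo[ : values of phi at negative reals are never used,
   and the derivative at 0 is one-sided. *)
Definition half_line_quotient phi (r s : R) : R := (phi s - phi r) / (s - r).

Definition half_line_derive phi (r : R) : R :=
  lim (half_line_quotient phi r s @[s --> within [set s | 0 <= s] r^']).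

Definition continuously_differentiable phi : Prop :=
  (forall r, 0 <= r ->
     cvg (half_line_quotient phi r s @[s --> within [set s | 0 <= s] r^'])) /\
  {within `[0, +oo[, continuous (half_line_derive phi)}.

Definition weight_integrable (q : R) phi : Prop :=
  (\int[lebesgue_measure]_(r in `[0%R, +oo[)
     (expR (- (q * phi r)) * r)%:E < +oo)%E.

Definition weight q phi : Prop :=
  [/\ forall r, 0 <= r -> 0 < phi r,
      continuously_differentiable phi
    & match q with
      | q'%:E => weight_integrable q' phi
      | +oo%E => exists2 q' : R, 0 < q' & weight_integrable q' phi
      | -oo%E => False
      end].

Definition class_C phi : Prop :=
  r * half_line_derive phi r @[r --> +oo] --> +oo.

(* R[i]^o is R[i] as a normed space over itself, so that [derivable] below is
   complex differentiability and functions form a vector space over R[i]. *)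
Definition entire (f : R[i] -> R[i]^o) : Prop :=
  forall z : R[i], derivable (f : R[i]^o -> R[i]^o) z 1.

Definition circle_point (r theta : R) : R[i] :=
  (r * cos theta) +i* (r * sin theta).

(* Only used for 1 <= p <= +oo; the -oo branch is a dummy value. *)
Definition integral_mean p (f : R[i] -> R[i]^o) (r : R) : \bar R :=
  match p with
  | p'%:E =>
      (((2 * pi)^-1)%:E *
        \int[lebesgue_measure]_(theta in `[0%R, (2 * pi)%R])
          (normc (f (circle_point r theta)) `^ p')%:E) `^ p'^-1
  | +oo => ereal_sup [set (normc (f z))%:E | z in [set z | normc z = r]]
  | -oo => 0
  end%E.

(* Only used for 1 <= q <= +oo; the -oo branch is a dummy value. *)
Definition fock_norm p q phi (f : R[i] -> R[i]^o) : \bar R :=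
  match q with
  | q'%:E =>
      (\int[lebesgue_measure]_(r in `[0%R, +oo[)
         ((integral_mean p f r) `^ q' *
          (expR (- (q' * phi r)) * r)%:E)) `^ q'^-1
  | +oo =>
      ereal_sup [set integral_mean p f r * (expR (- phi r))%:E
                | r in [set r | (0 <= r)%R]]
  | -oo => 0
  end%E.

Definition fock p q phi : set (R[i] -> R[i]^o) :=
  [set f | entire f /\ (fock_norm p q phi f < +oo)%E].

Section ComplexIntegral.
Context {d : measure_display} {T : measurableType d}.
Variables (mu : {measure set T -> \bar R}) (D : set T) (g : T -> R[i]).

Definition cintegrable : Prop :=
  mu.-integrable D (fun t => (complex.Re (g t))%:E) /\
  mu.-integrable D (fun t => (complex.Im (g t))%:E).

Definition cintegral : R[i] :=
  (\int[mu]_(t in D) complex.Re (g t)) +i* (\int[mu]_(t in D) complex.Im (g t)).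

End ComplexIntegral.

(* A Borel measure on (0, +oo) is given as a Borel measure on R of which only
   the restriction to (0, +oo) is used. *)
Definition hausdorff_integrand (f : R[i] -> R[i]^o) (z : R[i]) (t : R) : R[i] :=
  t%:C^-1 * f (z / t%:C).

Definition hausdorff (mu : {measure set (measurableTypeR R) -> \bar R})
    (f : R[i] -> R[i]^o) : R[i] -> R[i]^o :=
  fun z => cintegral mu `]0, +oo[ (hausdorff_integrand f z).

(* [cintegral] is total; this says that the formula makes sense on all of the
   space X. *)
Definition hausdorff_defined
    (mu : {measure set (measurableTypeR R) -> \bar R})
    (X : set (R[i] -> R[i]^o)) : Prop :=
  forall f, X f -> forall z : R[i],
    cintegrable mu `]0, +oo[ (hausdorff_integrand f z).

Definition hausdorff_uniformly_mean_ergodic p q phi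
    (mu : {measure set (measurableTypeR R) -> \bar R}) : Prop :=
  hausdorff_defined mu (fock p q phi) /\
  uniformly_mean_ergodic (fock p q phi) (fock_norm p q phi) (hausdorff mu).

End Fock.

(* Main.v *)
From mathcomp Require Import all_boot all_order all_algebra.
From mathcomp Require Import all_classical all_reals all_analysis.
From mathcomp Require Import measurable_realfun complex ring lra.
Require Import Defs.
Set Implicit Arguments.
Unset Strict Implicit.
Unset Printing Implicit Defensive.
Import Order.TTheory GRing.Theory Num.Theory.
Import numFieldNormedType.Exports.
Import ComplexField.Normc.
Local Open Scope classical_set_scope.
Local Open Scope complex_scope.
Local Open Scope ring_scope.

(** Write [H] for the Hausdorff operator and [m_n] for the integral of
    [t ^ -(n + 1)] over [t > 1].  The operator multiplies [z ^ n] by [m_n].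

    Necessity.  [H] multiplies constants by [m_0], and every function of the
    space satisfies [N (f 0) <= N f] for the norm [N], the value [f 0] being read
    as a constant function.  If the Cesaro means converge in operator norm, the
    numbers [(m_0 + ... + m_0 ^ n) / n] therefore stay bounded, so [m_0 <= 1].

    Sufficiency.  As [t > 1], the maximum principle bounds [H f] on a circle by
    [m_0] times the supremum of [f] on the same circle, and Schwarz's lemma
    improves [m_0] to [m_1] if [f 0 = 0].  If [m_0 < 1], the powers of [H]
    decay geometrically and the Cesaro means tend to 0.  If [m_0 = 1], then
    [m_1 < 1]; constants are fixed, [H ^ k f - f 0 = H ^ k (f - f 0)] is at most
    [2 m_1 ^ k] times the supremum of [f], and the means tend to the projection
    [f |-> f 0] at speed [1 / n].

    These are bounds between suprema on circles.  The lemma [transference] turns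
    a bound of this kind into the same bound between power means, for every
    linear operator that commutes with rotations; in particular it applies
    directly to the difference between a Cesaro mean and its limit.  Its proof
    dualizes a power mean over the vertices of a regular polygon, which replaces
    the function by a finite combination of its rotations.  Integrating the bounds between power
    means against the weight gives the bounds between norms
    ([fock_norm_operator_le]).

    The facts from complex analysis are derived from differentiability alone:
    Goursat's theorem on rectangles ([Goursat]), transported by the exponential
    to annuli ([circle_mean_const]), gives [Cauchy_formula], and from there
    [max_modulus], [Schwarz] and the second-order expansion [taylor2], by which
    [H f] is again entire. *)

(** * The complex modulus and complex-valued integrals *)

Section ComplexModulus.
Context {R : rcfType}.
Implicit Types (x y z : R[i]) (a b : R).

Lemma normc_ge0 z : 0 <= normc z.
Proof. by case: z => a b; exact: sqrtr_ge0. Qed.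

Lemma normcD_le x y : normc (x + y) <= normc x + normc y.
Proof. exact: le_normcD. Qed.

Lemma normcN_eq z : normc (- z) = normc z.
Proof. exact: normcN. Qed.

Lemma normcB_le x y : normc (x - y) <= normc x + normc y.
Proof. by rewrite -[normc y]normcN_eq; exact: normcD_le. Qed.

Lemma normc_distC x y : normc (x - y) = normc (y - x).
Proof. by rewrite -normcN_eq opprB. Qed.

Lemma normc_sub_ge x y : normc x - normc y <= normc (x - y).
Proof. by rewrite lerBlDr -{1}(subrK y x); exact: normcD_le. Qed.

Lemma normc_real a : normc a%:C = `|a|.
Proof. by rewrite /= expr0n /= addr0 sqrtr_sqr. Qed.

Lemma rcD a b : (a + b)%:C = a%:C + b%:C :> R[i].
Proof. exact: rmorphD. Qed.
Lemma rcB a b : (a - b)%:C = a%:C - b%:C :> R[i].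
Proof. exact: rmorphB. Qed.
Lemma rcM a b : (a * b)%:C = a%:C * b%:C :> R[i].
Proof. exact: rmorphM. Qed.
Lemma rcV a : (a^-1)%:C = a%:C^-1 :> R[i].
Proof. exact: fmorphV. Qed.

Lemma normc_nat n : normc (n%:R : R[i]) = n%:R.
Proof. by rewrite -(rmorph_nat (real_complex R)) normc_real normr_nat. Qed.

Lemma normc_i : normc ('i : R[i]) = 1.
Proof. by rewrite /= expr0n add0r expr1n sqrtr1. Qed.

Lemma normcX z n : normc (z ^+ n) = normc z ^+ n.
Proof. by elim: n => [|n IH]; rewrite ?expr0 ?normc1 // !exprS normcM IH. Qed.

Lemma normc_eq0 z : (normc z == 0) = (z == 0).
Proof. by apply/eqP/eqP => [/eq0_normc//|->]; rewrite normc0. Qed.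

Lemma normc_gt0 z : (0 < normc z) = (z != 0).
Proof. by rewrite lt_def normc_eq0 normc_ge0 andbT. Qed.

Lemma normc_sum (I : Type) (s : seq I) (F : I -> R[i]) :
  normc (\sum_(i <- s) F i) <= \sum_(i <- s) normc (F i).
Proof.
elim: s => [|i s IH]; first by rewrite !big_nil normc0.
by rewrite !big_cons (le_trans (normcD_le _ _)) // lerD2l.
Qed.

Lemma Re_le_normc z : `|complex.Re z| <= normc z.
Proof.
by case: z => a b /=; rewrite -sqrtr_sqr ler_wsqrtr // lerDl sqr_ge0.
Qed.

Lemma Im_le_normc z : `|complex.Im z| <= normc z.
Proof.
by case: z => a b /=; rewrite -sqrtr_sqr ler_wsqrtr // lerDr sqr_ge0.
Qed.

Lemma normc_le_ReIm z : normc z <= `|complex.Re z| + `|complex.Im z|.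
Proof.
rewrite {1}[z]complexE (le_trans (normcD_le _ _)) // normcM normc_i mul1r.
by rewrite !normc_real.
Qed.

Lemma ReD x y : complex.Re (x + y) = complex.Re x + complex.Re y.
Proof. by case: x; case: y. Qed.
Lemma ImD x y : complex.Im (x + y) = complex.Im x + complex.Im y.
Proof. by case: x; case: y. Qed.
Lemma ReM x y : complex.Re (x * y) =
  complex.Re x * complex.Re y - complex.Im x * complex.Im y.
Proof. by case: x; case: y. Qed.
Lemma ImM x y : complex.Im (x * y) =
  complex.Re x * complex.Im y + complex.Im x * complex.Re y.
Proof. by case: x; case: y. Qed.
Lemma ReN x : complex.Re (- x) = - complex.Re x. Proof. by case: x. Qed.
Lemma ImN x : complex.Im (- x) = - complex.Im x. Proof. by case: x. Qed.

Lemma complex_ext x y :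
  complex.Re x = complex.Re y -> complex.Im x = complex.Im y -> x = y.
Proof. by case: x => a b; case: y => c d /= -> ->. Qed.

Lemma normc_conjc z : normc (conjc z) = normc z.
Proof. by case: z => a b /=; rewrite sqrrN. Qed.

Lemma mul_conjc_normc z : conjc z * z = (normc z ^+ 2)%:C.
Proof.
case: z => a b /=; rewrite sqr_sqrtr ?addr_ge0 ?sqr_ge0 //.
by apply: complex_ext; rewrite ?ReM ?ImM /=; ring.
Qed.

Lemma exists_unimodular z :
  exists2 c, normc c = 1 & c * z = (normc z)%:C.
Proof.
have [->|z0] := eqVneq z 0.
  by exists 1; rewrite ?normc1 // mulr0 normc0.
have nz0 : normc z != 0 by rewrite normc_eq0.
exists ((normc z)^-1%:C * conjc z).
  rewrite normcM normc_conjc normc_real ger0_norm ?invr_ge0 ?normc_ge0 //.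
  by rewrite mulVf.
by rewrite -mulrA mul_conjc_normc -rmorphM expr2 mulrA mulVf // mul1r.
Qed.

End ComplexModulus.

Section ComplexIntegral.
Context d {T : measurableType d} {R : realType}.
Variables (mu : {measure set T -> \bar R}) (D : set T).
Hypothesis mD : measurable D.
Implicit Types (g h : T -> R[i]) (a : R[i]).

Lemma cintegrableMD a g h : cintegrable mu D g -> cintegrable mu D h ->
  cintegrable mu D (fun t => a * g t + h t).
Proof.
move=> [rg ig] [rh ih]; split.
- have H := integrableD mD (integrableD mD (integrableZl mD (complex.Re a) rg)
    (integrableZl mD (- complex.Im a) ig)) rh.
  apply: eq_integrable H => // t _ /=.
  by rewrite -!EFinM -!EFinD ReD ReM; congr EFin; ring.
- have H := integrableD mD (integrableD mD (integrableZl mD (complex.Re a) ig)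
    (integrableZl mD (complex.Im a) rg)) ih.
  apply: eq_integrable H => // t _ /=.
  by rewrite -!EFinM -!EFinD ImD ImM; congr EFin; ring.
Qed.

Lemma cintegralMD a g h : cintegrable mu D g -> cintegrable mu D h ->
  cintegral mu D (fun t => a * g t + h t) =
  a * cintegral mu D g + cintegral mu D h.
Proof.
move=> [rg ig] [rh ih]; apply: complex_ext; rewrite /cintegral.
- rewrite ReD ReM /=.
  under eq_Rintegral do rewrite ReD ReM -mulNr.
  rewrite !RintegralD // ?RintegralZl // ?mulNr //.
  + exact: (integrableZl mD _ rg).
  + exact: (integrableZl mD _ ig).
  + exact: (integrableD mD (integrableZl mD _ rg) (integrableZl mD _ ig)).
- rewrite ImD ImM /=.
  under eq_Rintegral do rewrite ImD ImM.
  rewrite !RintegralD // ?RintegralZl //.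
  + exact: (integrableZl mD _ ig).
  + exact: (integrableZl mD _ rg).
  + exact: (integrableD mD (integrableZl mD _ ig) (integrableZl mD _ rg)).
Qed.

Lemma eq_cintegral g h : {in D, g =1 h} -> cintegral mu D g = cintegral mu D h.
Proof.
by move=> gh; congr Complex; apply: eq_Rintegral => t tD; rewrite gh.
Qed.

Lemma cintegrable0 : cintegrable mu D (fun=> 0).
Proof. by split; apply: integrable0. Qed.

Lemma cintegral0 : cintegral mu D (fun=> 0) = 0.
Proof. by rewrite /cintegral /Rintegral !integral0. Qed.

Lemma cintegrableZ a g : cintegrable mu D g ->
  cintegrable mu D (fun t => a * g t).
Proof.
move=> gi; have := cintegrableMD a gi cintegrable0.
by under eq_fun do rewrite addr0.
Qed.

Lemma cintegralZ a g : cintegrable mu D g ->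
  cintegral mu D (fun t => a * g t) = a * cintegral mu D g.
Proof.
move=> gi; have := cintegralMD a gi cintegrable0.
by rewrite cintegral0 addr0; under eq_fun do rewrite addr0.
Qed.

(** Rotating the integral onto the positive half-line reduces the estimate to
    the real part, so that no constant is lost. *)
Lemma normc_cintegral_le g (G : T -> R) : cintegrable mu D g ->
  mu.-integrable D (EFin \o G) -> (forall t, D t -> normc (g t) <= G t) ->
  normc (cintegral mu D g) <= \int[mu]_(t in D) G t.
Proof.
move=> gi Gi gG; have [c c1 cE] := exists_unimodular (cintegral mu D g).
have -> : normc (cintegral mu D g) = complex.Re (c * cintegral mu D g).
  by rewrite cE.
rewrite -cintegralZ //=; apply: le_Rintegral => //.
  by have [] := cintegrableZ c gi.
move=> t Dt; apply: le_trans (ler_norm _) _; apply: le_trans (Re_le_normc _) _.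
by rewrite normcM c1 mul1r gG.
Qed.

End ComplexIntegral.

(** * Real integrals over the unit interval *)

Section UnitIntegralReal.
Context {R : realType}.
Notation leb := (@lebesgue_measure R).
Implicit Types f : R -> R.

Lemma continuous_itv_integrable f (a b : R) : continuous f ->
  leb.-integrable `[a, b] (EFin \o f).
Proof.
move=> cf; apply: continuous_compact_integrable; first exact: segment_compact.
exact: continuous_subspaceT.
Qed.

Lemma Rintegral_affine f (a c : R) : continuous f -> 0 < c ->
  \int[leb]_(x in `[a, a + c]) f x =
  c * \int[leb]_(u in `[0, 1]) f (a + c * u).
Proof.
move=> cf c0; pose F := fun u : R => a + c * u.
have dF (u : R^o) : is_derive u (1 : R^o) (F : R^o -> R^o) c.
  have -> : F = cst a + c \*: (@id R^o) by [].
  by apply: is_derive_eq; rewrite /GRing.scale /= mulr1 add0r.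
have F'E : F^`()%classic = cst c.
  by apply/funext => u; rewrite derive1E; apply: derive_val.
have cF : continuous F.
  by move=> u; apply: differentiable_continuous; apply/derivable1_diffP.
have H := @integration_by_substitution_increasing R F f 0 1 ler01.
rewrite /Rintegral.
have -> : `[a, a + c]%classic = `[F 0, F 1]%classic.
  by rewrite /F mulr0 mulr1 addr0.
rewrite H; last 1 first.
- exact: continuous_subspaceT.
- have -> : (fun x => (((f \o F) * F^`()%classic) x)%:E) =
      (fun x => c%:E * (f (F x))%:E)%E.
    by rewrite F'E; apply/funext => x; rewrite -EFinM mulrC.
  rewrite integralZl //; last first.
    apply: (@continuous_itv_integrable (f \o F)).
    by move=> u; apply: continuous_comp; [exact: cF|exact: cf].
  rewrite fineM //.
  apply: integrable_fin_num => //.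
  apply: (@continuous_itv_integrable (f \o F)).
  by move=> u; apply: continuous_comp; [exact: cF|exact: cf].
- by move=> x y _ _ xy; rewrite /F ltrD2l ltr_pM2l.
- by rewrite F'E => u _; exact: cst_continuous.
- by rewrite F'E; exact: is_cvg_cst.
- by rewrite F'E; exact: is_cvg_cst.
- split.
  + by move=> u _; exact: ex_derive.
  + by apply: cvg_at_right_filter; exact: cF.
  + by apply: cvg_at_left_filter; exact: cF.
Qed.

Lemma Rintegral_halve f : continuous f ->
  \int[leb]_(u in `[0, 1]) f u =
  2^-1 * (\int[leb]_(u in `[0, 1]) f (2^-1 * u) +
          \int[leb]_(u in `[0, 1]) f (2^-1 + 2^-1 * u)).
Proof.
move=> cf; have h0 : 0 < 2^-1 :> R by rewrite invr_gt0.
have i01 := continuous_itv_integrable 0 1 cf.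
have := @Rintegral_itvB R f (BLeft 0) (BRight 1) 2^-1 i01.
rewrite !bnd_simp => /(_ (ltW h0)) H.
have {}H := H ltac:(lra).
have {H} -> : \int[leb]_(u in `[0, 1]) f u =
    \int[leb]_(u in `[0, 2^-1]) f u + \int[leb]_(u in `]2^-1, 1]) f u.
  by rewrite -H addrC subrK.
rewrite mulrDr -(Rintegral_affine _ cf h0); congr (_ + _).
  have -> : `[0, 2^-1]%classic = `[0%R, 0 + 2^-1]%classic :> set R.
    by rewrite add0r.
  rewrite (Rintegral_affine _ cf h0).
  by under [in LHS]eq_Rintegral do rewrite add0r.
have -> : 2^-1 + 2^-1 = 1 :> R by lra.
rewrite Rintegral_itv_obnd_cbnd //.
apply: integrableS i01 => //.
by apply: subset_itv; rewrite bnd_simp // ltW.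
Qed.

Lemma Rintegral_unit_cst (c : R) : \int[leb]_(u in `[0%R, 1%R]) c = c.
Proof.
rewrite Rintegral_cst //=.
rewrite lebesgue_measure_itv /= lte_fin ltr01.
by rewrite sube0 /= mulr1.
Qed.

End UnitIntegralReal.

(** * Continuous curves in the plane *)

Section Curves.
Context {R : realType}.
Implicit Types (f g h : R[i] -> R[i]) (phi psi : R -> R[i]) (z w : R[i]).

(** Continuity and, below, differentiability are stated with the real modulus
    [normc], so that all estimates take place in the ordered field [R]. *)
Definition continuous_at h z := forall e, 0 < e ->
  exists2 d, 0 < d & forall w, normc (w - z) < d -> normc (h w - h z) <= e.

Definition curve phi := forall u e, 0 < e ->
  exists2 d, 0 < d & forall v, `|v - u| < d -> normc (phi v - phi u) <= e.

Lemma curve_comp h phi : curve phi -> (forall u, continuous_at h (phi u)) ->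
  curve (h \o phi).
Proof.
move=> cphi ch u e e0; have [d d0 dP] := ch u e e0.
have d20 : 0 < d / 2 by rewrite divr_gt0.
have [d' d'0 d'P] := cphi u _ d20; exists d' => // v /d'P uv.
by apply: dP; apply: le_lt_trans uv _; lra.
Qed.

Lemma curveD phi psi : curve phi -> curve psi -> curve (fun u => phi u + psi u).
Proof.
move=> c1 c2 u e e0; have e20 : 0 < e / 2 by rewrite divr_gt0.
have [d d0 dP] := c1 u _ e20; have [d' d'0 d'P] := c2 u _ e20.
exists (Num.min d d'); first by rewrite lt_min d0.
move=> v; rewrite lt_min => /andP[/dP h1 /d'P h2].
have -> : phi v + psi v - (phi u + psi u) = (phi v - phi u) + (psi v - psi u)
  by ring.
by apply: le_trans (normcD_le _ _) _; lra.
Qed.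

Lemma curveM phi psi : curve phi -> curve psi -> curve (fun u => phi u * psi u).
Proof.
move=> c1 c2 u e e0.
pose M := normc (phi u) + normc (psi u) + 1.
have M1 : 1 <= M by rewrite /M lerDr addr_ge0 ?normc_ge0.
have M0 : 0 < M by lra.
pose k := Num.min 1 (e / (M + M)).
have k0 : 0 < k by rewrite lt_min ltr01 divr_gt0 // addr_gt0.
have k1 : k <= 1 by rewrite /k ge_min lexx.
have kM : k * (M + M) <= e.
  rewrite -ler_pdivlMr; last by rewrite addr_gt0.
  by rewrite /k ge_min lexx orbT.
have [d d0 dP] := c1 u _ k0; have [d' d'0 d'P] := c2 u _ k0.
exists (Num.min d d'); first by rewrite lt_min d0.
move=> v; rewrite lt_min => /andP[/dP h1 /d'P h2].
have -> : phi v * psi v - phi u * psi u =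
  (phi v - phi u) * (psi v - psi u) + (phi v - phi u) * psi u +
  phi u * (psi v - psi u) by ring.
apply: le_trans (normcD_le _ _) _.
apply: le_trans (lerD (normcD_le _ _) (lexx _)) _; rewrite !normcM.
have := normc_ge0 (phi v - phi u); have := normc_ge0 (psi v - psi u).
have := normc_ge0 (phi u); have := normc_ge0 (psi u).
move: h1 h2 kM M1 k1 k0; rewrite /M.
move: (normc (phi v - phi u)) (normc (psi v - psi u)) (normc (phi u)).
move: (normc (psi u)) => a b c t h1 h2 kM M1 k1 k0 a0 t0 c0 b0.
have : b * c <= k * 1 by apply: ler_pM => //; lra.
have : b * a <= k * a by apply: ler_wpM2r.
have : t * c <= t * k by apply: ler_wpM2l.
by lra.
Qed.

Lemma curve_cst z : curve (fun=> z).
Proof.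
by move=> u e e0; exists 1 => // v _; rewrite subrr normc0 ltW.
Qed.

Lemma curve_real (a b : R) : curve (fun u => (a + b * u)%:C).
Proof.
move=> u e e0; exists (e / (`|b| + 1)).
  by rewrite divr_gt0 // ltr_wpDl.
move=> v uv; rewrite -rmorphB normc_real.
have -> : a + b * v - (a + b * u) = b * (v - u) by ring.
rewrite normrM; have b1 : 0 < `|b| + 1 by rewrite ltr_wpDl.
move: uv; rewrite ltr_pdivlMr // => uv.
apply: le_trans (ltW uv); rewrite mulrC ler_wpM2l // lerDl //.
Qed.

Lemma curve_affine phi (a b : R) : curve phi -> curve (fun u => phi (a + b * u)).
Proof.
move=> c u e e0; have [d d0 dP] := c (a + b * u) e e0.
have d20 : 0 < d / 2 by rewrite divr_gt0.
have [d' d'0 d'P] := curve_real a b u d20; exists d' => // v /d'P uv.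
apply: dP; apply: le_lt_trans (_ : d / 2 < d); last by lra.
by move: uv; rewrite -rmorphB normc_real.
Qed.

Lemma curve_continuous (F : R[i] -> R) phi : curve phi ->
  (forall z w, `|F z - F w| <= normc (z - w)) -> continuous (F \o phi).
Proof.
move=> c FP u; apply/cvgrPdist_le => e e0.
have [d d0 dP] := c u e e0; near=> v.
apply: le_trans (FP _ _) _; rewrite normc_distC; apply: dP.
near: v; have := @nbhsx_ballx R R u d d0; apply: filterS => v.
by rewrite /ball /= distrC.
Unshelve. all: by end_near. Qed.

Lemma curve_Re phi : curve phi -> continuous (fun u => complex.Re (phi u)).
Proof.
by move=> /curve_continuous; apply=> z w; rewrite -ReN -ReD; exact: Re_le_normc.
Qed.

Lemma curve_Im phi : curve phi -> continuous (fun u => complex.Im (phi u)).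
Proof.
by move=> /curve_continuous; apply=> z w; rewrite -ImN -ImD; exact: Im_le_normc.
Qed.

Lemma curve_normc phi : curve phi -> continuous (fun u => normc (phi u)).
Proof.
move=> /curve_continuous; apply=> z w; rewrite ler_norml normc_sub_ge andbT.
by rewrite lerNl opprB (le_trans (normc_sub_ge _ _)) // normc_distC.
Qed.

Lemma continuous_real_at (f : R -> R) u e : continuous f -> 0 < e ->
  exists2 d, 0 < d & forall v, `|v - u| < d -> `|f v - f u| <= e.
Proof.
move=> cf e0; have /cvgrPdist_le /(_ e e0) := cf u.
move=> /nbhs_ballP[d d0 dP]; exists d => // v uv.
by rewrite distrC; apply: dP; rewrite /ball /= distrC.
Qed.

End Curves.

Section UnitIntegral.
Context {R : realType}.
Notation leb := (@lebesgue_measure R).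
Implicit Types (phi psi : R -> R[i]) (z w : R[i]).

Definition unit_integral phi : R[i] := cintegral leb `[0%R, 1%R] phi.

Lemma curve_cintegrable phi : curve phi -> cintegrable leb `[0%R, 1%R] phi.
Proof.
move=> c; split; apply: continuous_itv_integrable.
  exact: curve_Re.
exact: curve_Im.
Qed.

Lemma unit_integralMD z phi psi : curve phi -> curve psi ->
  unit_integral (fun u => z * phi u + psi u) =
  z * unit_integral phi + unit_integral psi.
Proof.
by move=> c1 c2; apply: cintegralMD => //; exact: curve_cintegrable.
Qed.

Lemma unit_integralZ z phi : curve phi ->
  unit_integral (fun u => z * phi u) = z * unit_integral phi.
Proof. by move=> c1; apply: cintegralZ => //; exact: curve_cintegrable. Qed.

Lemma unit_integralB phi psi : curve phi -> curve psi ->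
  unit_integral (fun u => phi u - psi u) =
  unit_integral phi - unit_integral psi.
Proof.
move=> c1 c2; rewrite addrC -mulN1r -unit_integralMD //.
by congr unit_integral; apply/funext => u; rewrite mulN1r addrC.
Qed.

Lemma unit_integral_cst z : unit_integral (fun=> z) = z.
Proof.
by case: z => a b; rewrite /unit_integral /cintegral !Rintegral_unit_cst.
Qed.

Lemma normc_unit_integral_le phi (B : R) : curve phi ->
  (forall u, 0 <= u <= 1 -> normc (phi u) <= B) ->
  normc (unit_integral phi) <= B.
Proof.
move=> c le_B; rewrite -(Rintegral_unit_cst B).
apply: (normc_cintegral_le (G := cst B) _ (curve_cintegrable c)) => //.
by apply: (@continuous_itv_integrable R (cst B)) => u; exact: cst_continuous.
Qed.

Lemma unit_integral_halve phi : curve phi -> unit_integral phi =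
  2^-1 * (unit_integral (fun u => phi (2^-1 * u)) +
          unit_integral (fun u => phi (2^-1 + 2^-1 * u))).
Proof.
move=> c; apply: complex_ext.
- have -> : 2^-1 = (2^-1)%:C :> R[i] by rewrite fmorphV rmorph_nat.
  by rewrite ReM ReD /= mul0r subr0 Rintegral_halve //; exact: curve_Re.
- have -> : 2^-1 = (2^-1)%:C :> R[i] by rewrite fmorphV rmorph_nat.
  by rewrite ImM ImD /= mul0r addr0 Rintegral_halve //; exact: curve_Im.
Qed.

End UnitIntegral.

(** * Goursat's theorem *)

Section Goursat.
Context {R : realType}.
Implicit Types (g h : R[i] -> R[i]) (z w : R[i]) (s t : R).

Definition cdiff_at h z := exists c, forall e, 0 < e -> exists2 d, 0 < d &
  forall w, normc (w - z) < d ->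
    normc (h w - h z - c * (w - z)) <= e * normc (w - z).

Lemma cdiff_continuous h z : cdiff_at h z -> continuous_at h z.
Proof.
move=> [c cP] e e0; have [d d0 dP] := cP 1 ltr01.
have k0 : 0 < normc c + 1 by rewrite ltr_wpDl ?normc_ge0.
exists (Num.min d (e / (normc c + 1))).
  by rewrite lt_min d0 divr_gt0.
move=> w; rewrite lt_min => /andP[/dP h1]; rewrite ltr_pdivlMr // => h2.
have -> : h w - h z = (h w - h z - c * (w - z)) + c * (w - z) by ring.
apply: le_trans (normcD_le _ _) _; rewrite normcM.
by move: h1 h2; rewrite mul1r; lra.
Qed.

Definition segment_mean g z w : R[i] := unit_integral (fun u => g (z + w * u%:C)).

(** [rect_integral g z s t] is the integral of [g] over the boundary of the
    rectangle with lower left corner [z] and side lengths [s] and [t], divided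
    by ['i]. *)
Definition rect_integral g z s t : R[i] :=
  t%:C * (segment_mean g (z + s%:C) ('i * t%:C) - segment_mean g z ('i * t%:C))
  + 'i * s%:C *
    (segment_mean g (z + 'i * t%:C) s%:C - segment_mean g z s%:C).

Lemma curve_segment z w : curve (fun u : R => z + w * u%:C).
Proof.
apply: curveD; first exact: curve_cst.
apply: curveM; first exact: curve_cst.
by have := @curve_real R 0 1; under eq_fun do rewrite add0r mul1r.
Qed.

Lemma curve_segment_comp g z w : (forall x, continuous_at g x) ->
  curve (fun u : R => g (z + w * u%:C)).
Proof. by move=> cg; apply: curve_comp => //; exact: curve_segment. Qed.

Lemma segment_mean_halve g z w : (forall x, continuous_at g x) ->
  segment_mean g z (w + w) = 2^-1 * (segment_mean g z w + segment_mean g (z + w) w).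
Proof.
move=> cg; rewrite /segment_mean unit_integral_halve; last first.
  exact: curve_segment_comp.
have half : (2^-1 : R)%:C = 2^-1 :> R[i] by rewrite rcV (rmorph_nat (real_complex R)).
congr (_ * (unit_integral _ + unit_integral _)); apply/funext => u; congr g.
- by rewrite rcM half; field.
- by rewrite rcD rcM half; field.
Qed.

Lemma rect_integral_quarter g z s t : (forall x, continuous_at g x) ->
  rect_integral g z (s + s) (t + t) =
  rect_integral g z s t + rect_integral g (z + s%:C) s t +
  rect_integral g (z + 'i * t%:C) s t +
  rect_integral g (z + s%:C + 'i * t%:C) s t.
Proof.
move=> cg; rewrite /rect_integral !rcD (mulrDr 'i) !segment_mean_halve //.
rewrite !addrA.
have -> : z + s%:C + 'i * t%:C + s%:C = z + s%:C + s%:C + 'i * t%:C by ring.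
have -> : z + 'i * t%:C + 'i * t%:C + s%:C = z + s%:C + 'i * t%:C + 'i * t%:C
  by ring.
have -> : z + 'i * t%:C + s%:C = z + s%:C + 'i * t%:C by ring.
by field.
Qed.

(** The four quarters add up to the whole, so one of them carries at least a
    quarter of the modulus. *)
Lemma rect_integral_quarter_max g z s t : 0 <= s -> 0 <= t ->
  (forall x, continuous_at g x) -> exists w,
  [/\ complex.Re z <= complex.Re w <= complex.Re z + s,
      complex.Im z <= complex.Im w <= complex.Im z + t &
      normc (rect_integral g z (s + s) (t + t)) <=
      4 * normc (rect_integral g w s t)].
Proof.
move=> s0 t0 cg; apply: contrapT => H.
pose P w := normc (rect_integral g z (s + s) (t + t)) <=
      4 * normc (rect_integral g w s t).
have nP a b : 0 <= a <= s -> 0 <= b <= t -> ~ P (z + a%:C + 'i * b%:C).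
  move=> ha hb Pz; apply: H; exists (z + a%:C + 'i * b%:C); split => //.
    by rewrite !ReD ReM /= mul0r mul1r; lra.
  by rewrite !ImD ImM /= mul0r mul1r; lra.
have s0s : 0 <= s <= s by rewrite s0 lexx.
have t0t : 0 <= t <= t by rewrite t0 lexx.
have H1 := nP 0 0 ltac:(by rewrite lexx) ltac:(by rewrite lexx).
have H2 := nP s 0 s0s ltac:(by rewrite lexx).
have H3 := nP 0 t ltac:(by rewrite lexx) t0t.
have H4 := nP s t s0s t0t.
rewrite mulr0 !addr0 in H1; rewrite mulr0 addr0 in H2; rewrite addr0 in H3.
move: H1 H2 H3 H4; rewrite /P rect_integral_quarter //.
move=> /negP; rewrite -ltNge => H1 /negP; rewrite -ltNge => H2.
move=> /negP; rewrite -ltNge => H3 /negP; rewrite -ltNge => H4.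
move: H1 H2 H3 H4.
set a := rect_integral g z s t; set b := rect_integral _ _ _ _.
set c := rect_integral _ _ _ _; set d := rect_integral _ _ _ _.
have : normc (a + b + c + d) <= normc a + normc b + normc c + normc d.
  apply: le_trans (normcD_le _ _) _; rewrite lerD2r.
  by apply: le_trans (normcD_le _ _) _; rewrite lerD2r; exact: normcD_le.
lra.
Qed.

Lemma nested_intervals (a l : nat -> R) :
  (forall n, 0 <= l n) -> (forall n, a n <= a n.+1) ->
  (forall n, a n.+1 + l n.+1 <= a n + l n) ->
  exists x, forall n, a n <= x <= a n + l n.
Proof.
move=> l0 ai bd.
have am : nondecreasing_seq a by apply/nondecreasing_seqP.
have bm : nonincreasing_seq (fun n => a n + l n) by apply/nonincreasing_seqP.
have ab m n : a m <= a n + l n.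
  apply: le_trans (am _ _ (leq_maxl m n)) _.
  apply: le_trans (_ : _ <= a (maxn m n) + l (maxn m n)) _; first by rewrite lerDl.
  exact: (bm _ _ (leq_maxr m n)).
exists (sup (range a)) => n; apply/andP; split.
  have ua : has_ubound (range a).
    by exists (a 0%N + l 0%N) => _ [m _ <-]; exact: ab.
  by apply: (ub_le_sup ua); exists n.
apply: ge_sup; first by exists (a 0%N); exists 0%N.
by move=> _ [m _ <-]; exact: ab.
Qed.

Lemma segment_mean_sub_affine g z w x a b : (forall y, continuous_at g y) ->
  segment_mean g (z + x) w - segment_mean g z w =
  segment_mean (fun y => g y - (a + b * y)) (z + x) w -
  segment_mean (fun y => g y - (a + b * y)) z w + b * x.
Proof.
move=> cg; rewrite /segment_mean.
have ca y : curve (fun u : R => a + b * (y + w * u%:C)).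
  apply: curveD; first exact: curve_cst.
  by apply: curveM; [exact: curve_cst|exact: curve_segment].
have cgs y := curve_segment_comp y w cg.
rewrite !unit_integralB //.
suff -> : b * x = unit_integral (fun u => a + b * (z + x + w * u%:C)) -
   unit_integral (fun u => a + b * (z + w * u%:C)) by ring.
rewrite -unit_integralB // -[LHS]unit_integral_cst; congr unit_integral.
by apply/funext => u; ring.
Qed.

(** The boundary integral of an affine function vanishes: opposite sides differ by
    a constant, and the two pairs of sides cancel since ['i * 'i = -1]. *)
Lemma rect_integral_sub_affine g z s t a b : (forall y, continuous_at g y) ->
  rect_integral g z s t = rect_integral (fun y => g y - (a + b * y)) z s t.
Proof.
move=> cg; rewrite /rect_integral.
rewrite (segment_mean_sub_affine z ('i * t%:C) s%:C a b cg).
rewrite (segment_mean_sub_affine z s%:C ('i * t%:C) a b cg).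
have i2 : 'i * 'i = -1 :> R[i] by rewrite -expr2 sqr_i.
rewrite !mulrDr -!addrA; congr (_ + _); rewrite !addrA.
have -> : 'i * s%:C * (b * ('i * t%:C)) = ('i * 'i) * (s%:C * b * t%:C) by ring.
by rewrite i2; ring.
Qed.

Lemma normc_rect_integral_le g z s t B : (forall y, continuous_at g y) ->
  0 <= s -> 0 <= t ->
  (forall a b, 0 <= a <= s -> 0 <= b <= t ->
     normc (g (z + a%:C + 'i * b%:C)) <= B) ->
  normc (rect_integral g z s t) <= 2 * (s + t) * B.
Proof.
move=> cg s0 t0 gB.
have segB y w : (forall u : R, 0 <= u <= 1 -> normc (g (y + w * u%:C)) <= B) ->
    normc (segment_mean g y w) <= B.
  by move=> H; apply: normc_unit_integral_le H; exact: curve_segment_comp.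
have mul01 (c u : R) : 0 <= c -> 0 <= u <= 1 -> 0 <= c * u <= c.
  by move=> c0 /andP[u0 u1]; rewrite mulr_ge0 //= ler_piMr.
have B1 : normc (segment_mean g (z + s%:C) ('i * t%:C)) <= B.
  apply: segB => u u01; rewrite -mulrA -rcM; apply: gB; last exact: mul01.
  by rewrite s0 lexx.
have B2 : normc (segment_mean g z ('i * t%:C)) <= B.
  apply: segB => u u01; rewrite -mulrA -rcM.
  have -> : z + 'i * (t * u)%:C = z + 0%:C + 'i * (t * u)%:C by rewrite addr0.
  by apply: gB; [rewrite lexx|exact: mul01].
have B3 : normc (segment_mean g (z + 'i * t%:C) s%:C) <= B.
  apply: segB => u u01; rewrite -rcM addrAC; apply: gB; first exact: mul01.
  by rewrite t0 lexx.
have B4 : normc (segment_mean g z s%:C) <= B.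
  apply: segB => u u01; rewrite -rcM.
  have -> : z + (s * u)%:C = z + (s * u)%:C + 'i * 0%:C by rewrite mulr0 addr0.
  by apply: gB; [exact: mul01|rewrite lexx].
rewrite /rect_integral; apply: le_trans (normcD_le _ _) _.
rewrite !normcM normc_i mul1r !normc_real !ger0_norm //.
have := le_trans (normcB_le _ _) (lerD B1 B2).
have := le_trans (normcB_le _ _) (lerD B3 B4).
move=> /(ler_wpM2l s0) h1 /(ler_wpM2l t0) h2.
apply: le_trans (lerD h2 h1) _; lra.
Qed.

(** Goursat's theorem: bisecting the rectangle and keeping a quarter with the
    largest integral leads to a point of differentiability, where [g] is affine
    up to an error that is small compared with the side length. *)
Lemma Goursat g z s t : 0 <= s -> 0 <= t -> (forall x, continuous_at g x) ->
  (forall a b, 0 <= a <= s -> 0 <= b <= t -> cdiff_at g (z + a%:C + 'i * b%:C)) ->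
  rect_integral g z s t = 0.
Proof.
move=> s0 t0 cg dg.
pose sn (n : nat) := s / 2 ^+ n; pose tn (n : nat) := t / 2 ^+ n.
have p2 (n : nat) : 0 < 2 ^+ n :> R by rewrite exprn_gt0.
have sn0 n : 0 <= sn n by rewrite divr_ge0 // ltW.
have tn0 n : 0 <= tn n by rewrite divr_ge0 // ltW.
have snS n : sn n = sn n.+1 + sn n.+1.
  by rewrite /sn exprS; field; rewrite gt_eqF.
have tnS n : tn n = tn n.+1 + tn n.+1.
  by rewrite /tn exprS; field; rewrite gt_eqF.
have /choice[F FP] : forall nw : nat * R[i], exists w', [/\
    complex.Re nw.2 <= complex.Re w' <= complex.Re nw.2 + sn nw.1.+1,
    complex.Im nw.2 <= complex.Im w' <= complex.Im nw.2 + tn nw.1.+1 &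
    normc (rect_integral g nw.2 (sn nw.1) (tn nw.1)) <=
    4 * normc (rect_integral g w' (sn nw.1.+1) (tn nw.1.+1))].
  by move=> [n w] /=; rewrite (snS n) (tnS n); exact: rect_integral_quarter_max.
pose zn := fix zn n := if n is m.+1 then F (m, zn m) else z.
have znS n : zn n.+1 = F (n, zn n) by [].
have [x xP] : exists x, forall n, complex.Re (zn n) <= x <= complex.Re (zn n) + sn n.
  apply: nested_intervals => // n; rewrite znS;
    have [/andP[h1 h2] _ _] := FP (n, zn n) => //.
  by rewrite (snS n) /= addrA lerD2r.
have [y yP] : exists y, forall n, complex.Im (zn n) <= y <= complex.Im (zn n) + tn n.
  apply: nested_intervals => // n; rewrite znS;
    have [_ /andP[h1 h2] _] := FP (n, zn n) => //.
  by rewrite (tnS n) /= addrA lerD2r.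
have big n : normc (rect_integral g z s t) <=
    4 ^+ n * normc (rect_integral g (zn n) (sn n) (tn n)).
  elim: n => [|n IH]; first by rewrite /sn /tn expr0 mul1r !divr1.
  have [_ _ h] := FP (n, zn n); apply: le_trans IH _.
  by rewrite exprSr -mulrA ler_wpM2l // exprn_ge0.
have dgx : cdiff_at g (x +i* y).
  have := xP 0%N; have := yP 0%N; rewrite /sn /tn /= !expr0 !divr1 => y1 x1.
  have -> : x +i* y = z + (x - complex.Re z)%:C + 'i * (y - complex.Im z)%:C.
    by apply: complex_ext; rewrite ?ReD ?ImD ?ReM ?ImM /=; ring.
  by apply: dg; lra.
have [c cP] := dgx.
apply/eqP; rewrite -normc_eq0 eq_le normc_ge0 andbT.
apply/ler_addgt0Pr => e e0; rewrite add0r.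
have K0 : 0 < 2 * (s + t) ^+ 2 + 1 by rewrite ltr_wpDl // mulr_ge0 // sqr_ge0.
have [d d0 dP] := cP (e / (2 * (s + t) ^+ 2 + 1)) ltac:(by rewrite divr_gt0).
set e' := e / _ in dP; have e'0 : 0 < e' by rewrite divr_gt0.
(* The limit point lies in every quarter, so a quarter of diameter below [d]
   is within reach of the affine approximation. *)
have [n nP] : exists n, (s + t) / 2 ^+ n < d.
  have H : (s + t) / d < (Num.bound ((s + t) / d))%:R.
    by apply: Num.Theory.archi_boundP; rewrite divr_ge0 ?addr_ge0 // ltW.
  exists (Num.bound ((s + t) / d)).
  rewrite ltr_pdivrMr // mulrC -ltr_pdivrMr //; apply: lt_trans H _.
  by rewrite -natrX ltr_nat ltn_expl.
apply: le_trans (big n) _.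
rewrite (rect_integral_sub_affine (zn n) (sn n) (tn n)
  (g (x +i* y) - c * (x +i* y)) c cg).
have st : sn n + tn n = (s + t) / 2 ^+ n by rewrite /sn /tn mulrDl.
have B : normc (rect_integral
    (fun y0 => g y0 - (g (x +i* y) - c * (x +i* y) + c * y0)) (zn n) (sn n) (tn n))
    <= 2 * (sn n + tn n) * (e' * (sn n + tn n)).
  apply: normc_rect_integral_le => //.
    move=> w; have := cg w => cgw.
    move=> r r0; have r2 : 0 < r / 2 by rewrite divr_gt0.
    have [d1 d10 d1P] := cgw _ r2.
    have nc : 0 < normc c + 1 by rewrite ltr_wpDl ?normc_ge0.
    exists (Num.min d1 (r / 2 / (normc c + 1))).
      by rewrite lt_min d10 divr_gt0.
    move=> v; rewrite lt_min => /andP[/d1P h1]; rewrite ltr_pdivlMr // => h2.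
    set k := g (x +i* y) - _.
    have -> : g v - (k + c * v) - (g w - (k + c * w)) =
      (g v - g w) - c * (v - w) by ring.
    apply: le_trans (normcB_le _ _) _; rewrite normcM.
    have := normc_ge0 (v - w); lra.
  move=> a b aP bP; set v := zn n + _ + _.
  have vE : normc (v - (x +i* y)) <= sn n + tn n.
    apply: le_trans (normc_le_ReIm _) _.
    rewrite ReD ImD ReN ImN /v !ReD !ImD !ReM !ImM /=.
    have xn := xP n; have yn := yP n.
    by apply: lerD; rewrite ler_norml; lra.
  have -> : g v - (g (x +i* y) - c * (x +i* y) + c * v) =
    g v - g (x +i* y) - c * (v - (x +i* y)) by ring.
  apply: le_trans (dP _ _) _; first by apply: le_lt_trans vE _; rewrite st.
  by rewrite ler_wpM2l // ltW.
apply: le_trans (ler_wpM2l _ B) _; first by rewrite exprn_ge0.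
rewrite st.
have -> : 4 ^+ n * (2 * ((s + t) / 2 ^+ n) * (e' * ((s + t) / 2 ^+ n))) =
   e' * (2 * (s + t) ^+ 2) * (4 ^+ n / (2 ^+ n * 2 ^+ n)).
  by field; rewrite gt_eqF.
have -> : (4 : R) = 2 * 2 by ring.
rewrite exprMn divff ?mulr1; last by rewrite mulf_neq0 // gt_eqF.
rewrite /e' mulrAC ler_pdivrMr // ler_wpM2l ?lerDl //; exact: ltW.
Qed.

End Goursat.

(** * Complex differentiability *)

Section Bridge.
Context {R : realType}.
Implicit Types (f g h : R[i] -> R[i]) (z w : R[i]).

Lemma normcE z : `|z| = (normc z)%:C.
Proof. by []. Qed.

Lemma gt0_complexE z : 0 < z -> 0 < complex.Re z /\ z = (complex.Re z)%:C.
Proof. by case: z => a b; rewrite ltcE /= => /andP[/eqP -> a0]. Qed.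

Lemma cdiff_atP f z : cdiff_at f z <-> derivable (f : R[i]^o -> R[i]^o) z 1.
Proof.
split.
- move=> [c cP]; apply/cvg_ex; exists c; apply/cvgrPdist_le => e.
  move=> /gt0_complexE[e0 eE]; have [d d0 dP] := cP _ e0.
  apply/nbhs_ballP; exists d%:C; first by rewrite /= ltcR.
  move=> h /=; rewrite /ball /= sub0r normrN normcE ltcR => hd h0.
  rewrite eE normcE lecR /= [h *: 1]mulr1.
  have := dP (h + z); rewrite addrK => /(_ hd) H.
  have nh : 0 < normc h by rewrite normc_gt0.
  rewrite -(ler_pM2r nh) -normcM; apply: le_trans H.
  rewrite le_eqVlt; apply/orP; left; apply/eqP; rewrite -normcN_eq.
  by congr normc; rewrite /GRing.scale /=; field.
- move=> /cvg_ex[c /cvgrPdist_le H]; exists c => e e0.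
  have eC : 0 < e%:C :> R[i] by rewrite ltcR.
  have /nbhs_ballP[d /= /gt0_complexE[d0 dE] dP] := H _ eC.
  exists (complex.Re d) => // w wd.
  have [->|wz] := eqVneq w z; first by rewrite !subrr mulr0 subr0 normc0 mulr0.
  have wz0 : w - z != 0 by rewrite subr_eq0.
  have := dP (w - z); rewrite /ball /= sub0r normrN normcE dE ltcR.
  move=> /(_ wd wz0); rewrite normcE lecR [(w - z) *: 1]mulr1 subrK => Hw.
  have nh : 0 < normc (w - z) by rewrite normc_gt0.
  rewrite -(ler_pM2r nh) -normcM in Hw; apply: le_trans Hw.
  rewrite le_eqVlt; apply/orP; left; apply/eqP; rewrite -normcN_eq.
  by congr normc; rewrite /GRing.scale /=; field.
Qed.

Lemma entireP f : entire f <-> forall z, cdiff_at f z.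
Proof. by split=> H z; apply/cdiff_atP. Qed.

Lemma cdiff_cst c z : cdiff_at (fun=> c) z.
Proof. by apply/cdiff_atP; exact: (@derivable_cst R[i] R[i]^o R[i]^o c). Qed.

Lemma cdiff_id z : cdiff_at id z.
Proof. by apply/cdiff_atP; exact: derivable_id. Qed.

Lemma cdiffD f g z : cdiff_at f z -> cdiff_at g z ->
  cdiff_at (fun w => f w + g w) z.
Proof. by move=> /cdiff_atP ? /cdiff_atP ?; apply/cdiff_atP; exact: derivableD. Qed.

Lemma cdiffN f z : cdiff_at f z -> cdiff_at (fun w => - f w) z.
Proof. by move=> /cdiff_atP ?; apply/cdiff_atP; exact: derivableN. Qed.

Lemma cdiffB f g z : cdiff_at f z -> cdiff_at g z ->
  cdiff_at (fun w => f w - g w) z.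
Proof. by move=> fz gz; apply: cdiffD => //; exact: cdiffN. Qed.

Lemma cdiffM f g z : cdiff_at f z -> cdiff_at g z ->
  cdiff_at (fun w => f w * g w) z.
Proof.
move=> /cdiff_atP df /cdiff_atP dg; apply/cdiff_atP.
have H := derivableM (V := R[i]^o) (f := f) (g := g) df dg.
have E : (f : R[i]^o -> R[i]) * g = (fun w => f w * g w) by [].
by rewrite E in H.
Qed.

Lemma cdiffV f z : f z != 0 -> cdiff_at f z -> cdiff_at (fun w => (f w)^-1) z.
Proof.
move=> f0 /cdiff_atP df; apply/cdiff_atP.
have H := @derivableV R[i] R[i]^o f z 1 f0 df.
exact: H.
Qed.

Lemma cdiffX f n z : cdiff_at f z -> cdiff_at (fun w => f w ^+ n) z.
Proof.
move=> df; elim: n => [|n IH].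
  by under eq_fun do rewrite expr0; exact: cdiff_cst.
by under eq_fun do rewrite exprS; exact: cdiffM.
Qed.

Lemma cdiff_sum (I : Type) (s : seq I) (F : I -> R[i] -> R[i]) z :
  (forall i, cdiff_at (F i) z) -> cdiff_at (fun w => \sum_(i <- s) F i w) z.
Proof.
move=> dF; elim: s => [|i s IH].
  by under eq_fun do rewrite big_nil; exact: cdiff_cst.
by under eq_fun do rewrite big_cons; exact: cdiffD.
Qed.

Lemma cdiff_comp f g z : cdiff_at g z -> cdiff_at f (g z) ->
  cdiff_at (fun w => f (g w)) z.
Proof.
move=> dg [c' c'P]; have cg := cdiff_continuous dg; have [c cP] := dg.
exists (c' * c) => e e0.
pose M := normc c + 1 + normc c'.
have M0 : 0 < M by rewrite /M; have := normc_ge0 c; have := normc_ge0 c'; lra.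
pose k := Num.min 1 (e / M).
have k0 : 0 < k by rewrite lt_min ltr01 divr_gt0.
have k1 : k <= 1 by rewrite /k ge_min lexx.
have kM : k * M <= e by rewrite -ler_pdivlMr // /k ge_min lexx orbT.
have [d1 d10 d1P] := cP _ k0; have [d2 d20 d2P] := c'P _ k0.
have d220 : 0 < d2 / 2 by rewrite divr_gt0.
have [d3 d30 d3P] := cg _ d220.
exists (Num.min d1 d3); first by rewrite lt_min d10.
move=> w; rewrite lt_min => /andP[/d1P h1 /d3P h3].
have {h3} /d2P h2 : normc (g w - g z) < d2 by apply: le_lt_trans h3 _; lra.
have -> : f (g w) - f (g z) - c' * c * (w - z) =
  (f (g w) - f (g z) - c' * (g w - g z)) +
  c' * (g w - g z - c * (w - z)) by ring.
apply: le_trans (normcD_le _ _) _; rewrite normcM.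
have h4 : normc (g w - g z) <= (normc c + 1) * normc (w - z).
  have -> : g w - g z = (g w - g z - c * (w - z)) + c * (w - z) by ring.
  apply: le_trans (normcD_le _ _) _; rewrite normcM.
  have := ler_wpM2r (normc_ge0 (w - z)) k1; lra.
have h5 := ler_wpM2l (normc_ge0 c') h1.
have h6 := ler_wpM2l (ltW k0) h4.
have h7 := ler_wpM2r (normc_ge0 (w - z)) kM.
apply: le_trans h7; apply: le_trans (lerD h2 h5) _.
by apply: le_trans (lerD h6 (lexx _)) _; rewrite /M; lra.
Qed.

Lemma cdiff_scale f c z : cdiff_at f (c * z) -> cdiff_at (fun w => f (c * w)) z.
Proof.
move=> df; apply: cdiff_comp => //; apply: cdiffM; first exact: cdiff_cst.
exact: cdiff_id.
Qed.

End Bridge.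

(** * The complex exponential *)

Section ComplexExponential.
Context {R : realType}.
Implicit Types (z w : R[i]) (r x y : R).

Lemma circle_pointE r x : circle_point r x = r%:C * circle_point 1 x.
Proof. by apply: complex_ext; rewrite ?ReM ?ImM /=; ring. Qed.

Lemma circle_point0 r : circle_point r 0 = r%:C.
Proof. by rewrite /circle_point cos0 sin0 mulr1 mulr0. Qed.

Lemma circle_pointD x y :
  circle_point 1 (x + y) = circle_point 1 x * circle_point 1 y.
Proof. by apply: complex_ext; rewrite ?ReM ?ImM /= ?cosD ?sinD; ring. Qed.

Lemma normc_circle_point r x : normc (circle_point r x) = `|r|.
Proof.
rewrite circle_pointE normcM normc_real /= !mul1r cos2Dsin2 sqrtr1 mulr1 //.
Qed.

Lemma circle_point_2pi r x : circle_point r (x + 2 * pi) = circle_point r x.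
Proof.
by rewrite /circle_point mulr_natl mulr2n addrA !cosDpi !sinDpi !opprK.
Qed.

Definition cexp z : R[i] := circle_point (expR (complex.Re z)) (complex.Im z).

Lemma cexpD z w : cexp (z + w) = cexp z * cexp w.
Proof.
rewrite /cexp ReD ImD circle_pointE expRD circle_pointD rcM.
by rewrite [in RHS]circle_pointE [circle_point _ (complex.Im w)]circle_pointE; ring.
Qed.

Lemma real_deriv_small (f : R -> R) (c e : R) : is_derive (0 : R^o) (1 : R^o) (f : R^o -> R^o) c -> 0 < e ->
  exists2 d, 0 < d & forall x, `|x| < d -> `|f x - f 0 - c * x| <= e * `|x|.
Proof.
move=> [df dE] e0; have {df}/cvgrPdist_le/(_ e e0) : (fun h : R => h^-1 *: (f (h *: 1 + 0) - f 0)) @ 0^' --> c.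
  by rewrite -dE.
move=> /nbhs_ballP[d /= d0 dP]; exists d => // x xd.
have [->|x0] := eqVneq x 0; first by rewrite subrr mulr0 subr0 normr0 mulr0.
have := dP x; rewrite /ball /= sub0r normrN => /(_ xd x0).
rewrite [x *: 1]mulr1 addr0 -(ler_pM2r (_ : 0 < `|x|)) ?normr_gt0 //.
rewrite -normrM => H; apply: le_trans H; rewrite le_eqVlt; apply/orP; left.
by rewrite -normrN; apply/eqP; congr `|_|; rewrite /GRing.scale /=; field.
Qed.

Lemma cdiff_cexp0 : cdiff_at cexp 0.
Proof.
(* The remainder splits into errors whose total is at most [9 * (k * normc z)]. *)
exists 1 => e e0; pose k := Num.min 1 (e / 9).
have k0 : 0 < k by rewrite lt_min ltr01 divr_gt0.
have k1 : k <= 1 by rewrite /k ge_min lexx.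
have ke : k <= e / 9 by rewrite /k ge_min lexx orbT.
have [d1 d10 d1P] := real_deriv_small (is_derive_expR 0) k0.
have [d2 d20 d2P] := real_deriv_small (is_derive_cos 0) k0.
have [d3 d30 d3P] := real_deriv_small (is_derive_sin 0) k0.
exists (Num.min (Num.min d1 d2) (Num.min d3 k)).
  by rewrite !lt_min d10 d20 d30 ltr01 divr_gt0.
case=> x y; rewrite subr0 !lt_min => /andP[/andP[h1 h2] /and3P[h3 h4 h4']].
set n := normc (x +i* y) in h1 h2 h3 h4 *.
have xn : `|x| <= n := Re_le_normc (x +i* y).
have yn : `|y| <= n := Im_le_normc (x +i* y).
have := d1P x (le_lt_trans xn h1); have := d2P y (le_lt_trans yn h2).
have := d3P y (le_lt_trans yn h3).
rewrite expR0 cos0 sin0 oppr0 mul0r !mul1r !subr0 addr0.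
set a := expR x - 1 - x; set b := cos y - 1; set c := sin y - y => hc hb ha.
have -> : cexp (x +i* y) - cexp 0 - (x +i* y) =
    (a + (1 + x + a) * b)%:C + 'i * ((x + a) * y + (1 + x + a) * c)%:C.
  rewrite /cexp /= expR0 circle_point0 /circle_point.
  have -> : expR x = 1 + x + a by rewrite /a; ring.
  have -> : cos y = 1 + b by rewrite /b; ring.
  have -> : sin y = y + c by rewrite /c; ring.
  by apply: complex_ext; rewrite ?ReD ?ReM ?ImD ?ImM ?ReN ?ImN ?ReM ?ImM /=; ring.
have n0 : 0 <= n := normc_ge0 _.
have ha' : `|a| <= k * n by apply: le_trans ha _; rewrite ler_wpM2l // ltW.
have hb' : `|b| <= k * n by apply: le_trans hb _; rewrite ler_wpM2l // ltW.
have hc' : `|c| <= k * n by apply: le_trans hc _; rewrite ler_wpM2l // ltW.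
have kn : k * n <= n by rewrite ler_piMl.
have n1 : n <= 1 by exact: ltW.
have nk : n <= k by rewrite /k le_min n1 ltW.
apply: le_trans (normcD_le _ _) _; rewrite normcM normc_i mul1r !normc_real.
have u3 : `|1 + x + a| <= 3.
  apply: le_trans (ler_normD _ _) _; have := ler_normD 1 x; rewrite normr1; lra.
have h5 : `|(1 + x + a) * b| <= 3 * (k * n) by rewrite normrM ler_pM.
have h6 : `|(1 + x + a) * c| <= 3 * (k * n) by rewrite normrM ler_pM.
have h7 : `|x + a| <= n + k * n.
  by apply: le_trans (ler_normD _ _) _; exact: lerD.
have h8 : `|(x + a) * y| <= (n + k * n) * n by rewrite normrM ler_pM.
have h9 : `|a + (1 + x + a) * b| <= 4 * (k * n).
  by apply: le_trans (ler_normD _ _) _; lra.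
have nn : n * n <= k * n by rewrite ler_wpM2r.
have h10 : (n + k * n) * n <= n * n + n * n.
  by rewrite mulrDl lerD2l ler_wpM2r.
have h11 : `|(x + a) * y + (1 + x + a) * c| <= 5 * (k * n).
  by apply: le_trans (ler_normD _ _) _; lra.
have h12 : 9 * (k * n) <= e * n by have := ler_wpM2r n0 ke; lra.
lra.
Qed.
End ComplexExponential.

(** * Means over circles *)

Section CircleMeans.
Context {R : realType}.
Implicit Types (f g h G : R[i] -> R[i]) (z w : R[i]) (r x y : R).

Lemma cdiff_cexp z : cdiff_at (@cexp R) z.
Proof.
have -> : @cexp R = (fun w => cexp z * cexp (w - z)).
  by apply/funext => w; rewrite -cexpD addrC subrK.
apply: cdiffM; first exact: cdiff_cst.
apply: (@cdiff_comp _ (@cexp R) (fun w => w - z)).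
  by apply: cdiffB; [exact: cdiff_id|exact: cdiff_cst].
by rewrite subrr; exact: cdiff_cexp0.
Qed.

Lemma cexp_neq0 z : cexp z != 0.
Proof.
by rewrite -normc_eq0 /cexp normc_circle_point normr_eq0 gt_eqF // expR_gt0.
Qed.

Lemma cexpE x y : cexp (x%:C + 'i * y%:C) = circle_point (expR x) y :> R[i].
Proof.
have -> : x%:C + 'i * y%:C = x +i* y :> R[i].
  by apply: complex_ext; rewrite ?ReD ?ImD ?ReM ?ImM /=; ring.
by [].
Qed.

Lemma curve_circle r : curve (fun u => circle_point r (2 * pi * u)).
Proof.
have -> : (fun u => circle_point r (2 * pi * u)) =
    (fun u => r%:C * cexp (0%:C + 'i * (2 * pi)%:C * u%:C)).
  apply/funext => u; rewrite circle_pointE; congr (_ * _).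
  by rewrite -['i * _ * _]mulrA -rcM cexpE expR0.
apply: curveM; first exact: curve_cst.
apply: (@curve_comp _ (@cexp R)); first exact: curve_segment.
by move=> u; apply: cdiff_continuous; exact: cdiff_cexp.
Qed.

Definition circle_mean h r := unit_integral (fun u => h (circle_point r (2 * pi * u))).

Lemma circle_point_neq0 r x : 0 < r -> circle_point r x != 0.
Proof. by move=> r0; rewrite -normc_gt0 normc_circle_point normr_gt0 gt_eqF. Qed.

Lemma curve_circle_comp h r : (forall x, continuous_at h (circle_point r x)) ->
  curve (fun u => h (circle_point r (2 * pi * u))).
Proof. by move=> ch; apply: curve_comp => //; exact: curve_circle. Qed.

(** In the coordinate [log z] an annulus is a rectangle whose horizontal sides
    are identified, so only the two circles contribute to its boundary
    integral. *)
Lemma circle_mean_const h r1 r2 : 0 < r1 -> r1 <= r2 ->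
  (forall z, z != 0 -> continuous_at h z) ->
  (forall z, r1 <= normc z <= r2 -> cdiff_at h z) ->
  circle_mean h r1 = circle_mean h r2.
Proof.
move=> r10 r12 ch dh; have r20 := lt_le_trans r10 r12.
pose g z := h (cexp z).
have cg z : continuous_at g z.
  move=> e e0; have [d d0 dP] := ch _ (cexp_neq0 z) e e0.
  have d20 : 0 < d / 2 by rewrite divr_gt0.
  have [d' d'0 d'P] := cdiff_continuous (cdiff_cexp z) d20.
  by exists d' => // w /d'P zw; apply: dP; apply: le_lt_trans zw _; lra.
have lnr : ln r1 <= ln r2 by rewrite ler_ln.
have mean_seg r : 0 < r ->
    segment_mean g (ln r)%:C ('i * (2 * pi)%:C) = circle_mean h r.
  move=> r0; congr unit_integral; apply/funext => u; rewrite /g; congr h.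
  by rewrite -['i * _ * _]mulrA -rcM cexpE lnK.
have pi0 := pi_gt0 R.
have := @Goursat R g (ln r1)%:C (ln r2 - ln r1) (2 * pi).
rewrite subr_ge0 lnr mulr_ge0 ?(ltW pi0) // => /(_ isT isT cg) H.
have {H} : rect_integral g (ln r1)%:C (ln r2 - ln r1) (2 * pi) = 0.
  apply: H => a b aP bP; apply: cdiff_comp; first exact: cdiff_cexp.
  rewrite -rcD cexpE; apply: dh.
  rewrite normc_circle_point gtr0_norm ?expR_gt0 //.
  rewrite -[X in X <= _ <= _]lnK // -[X in _ <= _ <= X]lnK // !ler_expR; lra.
rewrite /rect_integral.
have <- : segment_mean g (ln r1)%:C (ln r2 - ln r1)%:C =
    segment_mean g ((ln r1)%:C + 'i * (2 * pi)%:C) (ln r2 - ln r1)%:C.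
  congr unit_integral; apply/funext => u; rewrite /g; congr h.
  rewrite addrAC -!rcM -!rcD cexpE.
  have -> : (ln r1 + (ln r2 - ln r1) * u)%:C =
    (ln r1 + (ln r2 - ln r1) * u)%:C + 'i * 0%:C :> R[i] by rewrite mulr0 addr0.
  by rewrite cexpE -[in RHS](add0r (2 * pi)) circle_point_2pi.
rewrite subrr mulr0 addr0 -rcD (addrC (ln r1)) subrK !mean_seg //.
move=> /eqP; rewrite mulf_eq0 subr_eq0 => /orP[/eqP[] /eqP|/eqP//].
by rewrite gt_eqF // mulr_gt0.
Qed.

(** Compactness of the unit interval makes continuity of [h] along a curve
    uniform, also towards points off the curve. *)
Lemma curve_uniform h phi : curve phi ->
  (forall u, 0 <= u <= 1 -> continuous_at h (phi u)) ->
  forall e, 0 < e -> exists2 d, 0 < d & forall u, 0 <= u <= 1 -> forall z,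
    normc (z - phi u) < d -> normc (h z - h (phi u)) <= e.
Proof.
move=> cphi ch e e0.
have K := (compact_near_coveringP _).1 (@segment_compact R 0 1).
pose P (d : R) (u : R) := forall z, normc (z - phi u) < d ->
  normc (h z - h (phi u)) <= e.
have H : \forall d \near (0 : R)^'+, `[0, 1]%classic `<=` P d.
  apply: K => u; rewrite /= in_itv /= => u01.
  have e20 : 0 < e / 2 by rewrite divr_gt0.
  have [d0 d00 d0P] := ch u u01 _ e20.
  have d020 : 0 < d0 / 2 by rewrite divr_gt0.
  have [d1 d10 d1P] := cphi u _ d020.
  near=> v d => z /= zv.
  have uv : `|v - u| < d1.
    near: v; have := @nbhsx_ballx R R u d1 d10; apply: filterS => v.
    by rewrite /ball /= distrC.
  have dd : d < d0 / 2 by near: d; exact: nbhs_right_lt.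
  have h1 := d1P v uv.
  have h2 : normc (h (phi v) - h (phi u)) <= e / 2 by apply: d0P; lra.
  have h3 : normc (h z - h (phi u)) <= e / 2.
    apply: d0P; have -> : z - phi u = (z - phi v) + (phi v - phi u) by ring.
    by apply: le_lt_trans (normcD_le _ _) _; lra.
  have -> : h z - h (phi v) = (h z - h (phi u)) - (h (phi v) - h (phi u)) by ring.
  by apply: le_trans (normcB_le _ _) _; lra.
have : \forall d \near (0 : R)^'+, 0 < d /\ `[0, 1]%classic `<=` P d.
  by near=> d; split; near: d => //; exact: nbhs_right_gt.
move=> /filter_ex[d [d0 dP]]; by exists d.
Unshelve. all: by end_near. Qed.

Lemma circle_mean_continuous h r0 : 0 < r0 ->
  (forall z, z != 0 -> continuous_at h z) ->
  forall e, 0 < e -> exists2 d, 0 < d & forall r, 0 < r -> `|r - r0| < d ->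
    normc (circle_mean h r - circle_mean h r0) <= e.
Proof.
move=> r00 ch e e0.
have c0 r : 0 < r -> curve (fun u => h (circle_point r (2 * pi * u))).
  by move=> r_gt0; apply: curve_circle_comp => x; apply/ch/circle_point_neq0.
have [d d0 dP] : exists2 d, 0 < d & forall u, 0 <= u <= 1 -> forall z,
    normc (z - circle_point r0 (2 * pi * u)) < d ->
    normc (h z - h (circle_point r0 (2 * pi * u))) <= e.
  apply: curve_uniform => //; first exact: curve_circle.
  by move=> u _; apply/ch/circle_point_neq0.
exists d => // r r_gt0 rd.
rewrite /circle_mean -unit_integralB //; try exact: c0.
apply: normc_unit_integral_le.
  apply: curveD; first exact: c0.
  have := curveM (curve_cst (-1)) (c0 _ r00).
  by under eq_fun do rewrite mulN1r.
move=> u u01; apply: dP => //.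
rewrite circle_pointE [circle_point r0 _]circle_pointE -mulrBl -rcB.
by rewrite -circle_pointE normc_circle_point.
Qed.

Lemma normc_circle_mean_le h r B : 0 < r ->
  (forall x, continuous_at h (circle_point r x)) ->
  (forall x, normc (h (circle_point r x)) <= B) ->
  normc (circle_mean h r) <= B.
Proof.
move=> r0 ch hB; apply: normc_unit_integral_le => [|u _]; last exact: hB.
exact: curve_circle_comp.
Qed.

Lemma cdiff_local f g z d : 0 < d -> (forall w, normc (w - z) < d -> f w = g w) ->
  cdiff_at f z -> cdiff_at g z.
Proof.
move=> d0 fg [c cP]; exists c => e e0; have [d' d'0 d'P] := cP e e0.
exists (Num.min d d'); first by rewrite lt_min d0.
move=> w; rewrite lt_min => /andP[wd /d'P]; rewrite !fg //.
by rewrite subrr normc0.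
Qed.

End CircleMeans.

Lemma geometric_le0 (R : realType) (a C rho : R) : 0 <= rho < 1 ->
  (forall n, a <= C * rho ^+ n) -> a <= 0.
Proof.
move=> /andP[rho0 rho1] aP.
have H : (fun n => C * rho ^+ n) @ \oo --> C * 0.
  by apply: cvgM; [exact: cvg_cst|apply: cvg_expr; rewrite ger0_norm].
rewrite -(mulr0 C); apply: (cvgr_to_ge H).
by near=> n; exact: aP.
Unshelve. all: by end_near. Qed.

(** * Cauchy's formula and the maximum principle *)

Section Cauchy.
Context {R : realType}.
Implicit Types (f g h G : R[i] -> R[i]) (z w c : R[i]) (r x y e : R).

(** This class contains [f z / z] for [f] entire with [f 0 = 0] and is closed
    under powers, so that the maximum principle on it yields Schwarz's lemma
    without removing the singularity. *)
Definition punctured_entire G : Prop :=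
  (forall z, z != 0 -> cdiff_at G z) /\
  exists B d, 0 < d /\ forall z, z != 0 -> normc z < d -> normc (G z) <= B.

Lemma le_all_eps (a : R) : (forall e, 0 < e -> a <= e) -> a <= 0.
Proof. by move=> H; apply/ler_addgt0Pr => e /H; rewrite add0r. Qed.

Lemma normc_le0 z : normc z <= 0 -> z = 0.
Proof.
by move=> z0; apply/eqP; rewrite -normc_eq0 eq_le z0 normc_ge0.
Qed.

Section Kernel.
Variables (G : R[i] -> R[i]) (w c : R[i]).
Hypothesis dG : forall z, z != 0 -> cdiff_at G z.
Hypothesis bG : exists B d, 0 < d /\
  forall z, z != 0 -> normc z < d -> normc (G z) <= B.
Hypothesis cP : forall e, 0 < e -> exists2 d, 0 < d & forall z,
  normc (z - w) < d -> normc (G z - G w - c * (z - w)) <= e * normc (z - w).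

(* The value at [w] makes the kernel continuous there. *)
Let h z := if z == w then w * c else z * (G z - G w) / (z - w).

Let hE z : z != w -> h z = z * (G z - G w) / (z - w).
Proof. by rewrite /h => /negbTE ->. Qed.

Let dh z : z != 0 -> z != w -> cdiff_at h z.
Proof.
move=> z0 zw.
have zw0 : 0 < normc (z - w) by rewrite normc_gt0 subr_eq0.
apply: (@cdiff_local _ (fun z => z * (G z - G w) / (z - w)) h z _ zw0).
  move=> v vz; rewrite hE //; apply: contraTneq vz => ->.
  by rewrite -leNgt normc_distC.
apply: cdiffM.
  by apply: cdiffM; [exact: cdiff_id|apply: cdiffB; [exact: dG|exact: cdiff_cst]].
apply: cdiffV; first by rewrite subr_eq0.
by apply: cdiffB; [exact: cdiff_id|exact: cdiff_cst].
Qed.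

Let ch_w : continuous_at h w.
Proof.
move=> e e0; have w1 : 0 < normc w + 1 by rewrite ltr_wpDl ?normc_ge0.
have c1 : 0 < normc c + 1 by rewrite ltr_wpDl ?normc_ge0.
have k0 : 0 < e / 2 / (normc w + 1) by rewrite !divr_gt0.
have [d d0 dP] := cP k0.
exists (Num.min (Num.min d 1) (e / 2 / (normc c + 1))).
  by rewrite !lt_min d0 ltr01 !divr_gt0.
move=> z; rewrite !lt_min => /andP[/andP[/dP h1 h2]].
rewrite ltr_pdivlMr // => h3.
rewrite [h w]/h eqxx; have [->|zw] := eqVneq z w.
  by rewrite /h eqxx subrr normc0 ltW.
rewrite hE //.
have zw0 : z - w != 0 by rewrite subr_eq0.
have -> : z * (G z - G w) / (z - w) - w * c =
  z * ((G z - G w - c * (z - w)) / (z - w)) + (z - w) * c by field.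
apply: le_trans (normcD_le _ _) _; rewrite !normcM normcV.
have nz0 : 0 < normc (z - w) by rewrite normc_gt0.
have h4 : normc z <= normc w + 1 by have := normc_sub_ge z w; lra.
have h5 : normc (G z - G w - c * (z - w)) / normc (z - w) <= e / 2 / (normc w + 1).
  by rewrite ler_pdivrMr.
have h6 := ler_pM (normc_ge0 z) (divr_ge0 (normc_ge0 _) (ltW nz0)) h4 h5.
have h7 : (normc w + 1) * (e / 2 / (normc w + 1)) = e / 2.
  by field; rewrite gt_eqF.
lra.
Qed.

Let ch z : z != 0 -> continuous_at h z.
Proof.
move=> z0; have [->|zw] := eqVneq z w; first exact: ch_w.
by apply: cdiff_continuous; exact: dh.
Qed.

Let J_small e : 0 < e -> exists2 d, 0 < d & forall r, 0 < r < d ->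
  normc (circle_mean h r) <= e.
Proof.
move=> e0; have [w0|w0] := eqVneq w 0.
  have [d d0 dP] := ch_w e0; exists d => // r /andP[r0 rd].
  apply: normc_circle_mean_le => // x; first exact/ch/circle_point_neq0.
  have := dP (circle_point r x); rewrite w0 subr0 normc_circle_point gtr0_norm //.
  by move=> /(_ rd); rewrite [h 0]/h w0 eqxx mul0r subr0.
have [B [d [d0 BP]]] := bG.
have nw : 0 < normc w by rewrite normc_gt0.
have K0 : 0 < `|B| + normc (G w) + 1.
  by rewrite ltr_wpDl // addr_ge0 // normc_ge0.
exists (Num.min (Num.min d (normc w / 2)) (e / (`|B| + normc (G w) + 1) * (normc w / 2))).
  have K1 : 0 < normc w / 2 by rewrite divr_gt0.
  have K2 : 0 < e / (`|B| + normc (G w) + 1) by rewrite divr_gt0.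
  by rewrite !lt_min d0 K1 (mulr_gt0 K2 K1).
move=> r /andP[r0]; rewrite !lt_min => /andP[/andP[rd rw] rK].
apply: normc_circle_mean_le => // x; first exact/ch/circle_point_neq0.
have nz : normc (circle_point r x) = r by rewrite normc_circle_point gtr0_norm.
set z := circle_point r x in nz *.
have h1 : normc w / 2 <= normc (z - w).
  by rewrite normc_distC; have := normc_sub_ge w z; lra.
have zw : z != w by rewrite -subr_eq0 -normc_gt0; lra.
rewrite hE // !normcM normcV nz ler_pdivrMr; last by lra.
have h2 : normc (G z - G w) <= `|B| + normc (G w) + 1.
  apply: le_trans (normcB_le _ _) _.
  have : normc (G z) <= B by apply: BP; rewrite ?nz // circle_point_neq0.
  have := ler_norm B; lra.
apply: le_trans (ler_wpM2l (ltW e0) h1).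
have h3 := ler_wpM2l (ltW r0) h2; apply: le_trans h3 _.
have h4 := ler_wpM2r (ltW K0) (ltW rK); apply: le_trans h4 _.
by rewrite le_eqVlt; apply/orP; left; apply/eqP; field; rewrite gt_eqF.
Qed.

Let J_lt r : 0 < r < normc w -> circle_mean h r = 0.
Proof.
move=> /andP[r0 rw]; apply: normc_le0; apply: le_all_eps => e e0.
have [d d0 dP] := J_small e0.
have m0 : 0 < Num.min (d / 2) r by rewrite lt_min r0 divr_gt0.
rewrite -(@circle_mean_const _ h (Num.min (d / 2) r) r) //.
- by apply: dP; rewrite m0 gt_min; apply/orP; left; lra.
- by rewrite ge_min lexx orbT.
- move=> z /andP[h1 h2]; apply: dh.
    by rewrite -normc_gt0; apply: lt_le_trans h1.
  by apply: contraTneq h2 => ->; rewrite -ltNge.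
Qed.

Let J_eq : w != 0 -> circle_mean h (normc w) = 0.
Proof.
move=> w0; have nw : 0 < normc w by rewrite normc_gt0.
apply: normc_le0; apply: le_all_eps => e e0.
have [d d0 dP] := circle_mean_continuous nw ch e0.
pose r := Num.max (normc w - d / 2) (normc w / 2).
have r0 : 0 < r by rewrite lt_max [X in _ || X]divr_gt0 // orbT.
have rw : r < normc w by rewrite gt_max; apply/andP; split; lra.
have rd : `|r - normc w| < d.
  rewrite ltr0_norm ?subr_lt0 // opprB.
  have : normc w - d / 2 <= r by rewrite /r le_max lexx.
  lra.
by have := dP r r0 rd; rewrite J_lt ?r0 // sub0r normcN_eq.
Qed.

Let J0 r : normc w < r -> circle_mean h r = 0.
Proof.
move=> wr; have r0 := le_lt_trans (normc_ge0 w) wr.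
apply: normc_le0; apply: le_all_eps => e e0.
have const r' : 0 < r' <= r -> normc w < r' -> circle_mean h r' = circle_mean h r.
  move=> /andP[r'0 r'r] wr'; apply: circle_mean_const => // z /andP[h1 h2].
  apply: dh; first by rewrite -normc_gt0; apply: lt_le_trans h1.
  by apply: contraTneq h1 => ->; rewrite -ltNge.
have [w0|w0] := eqVneq w 0.
  have [d d0 dP] := J_small e0.
  have m0 : 0 < Num.min (d / 2) r by rewrite lt_min r0 divr_gt0.
  rewrite -(const (Num.min (d / 2) r)).
  - by apply: dP; rewrite m0 gt_min; apply/orP; left; lra.
  - by rewrite m0 ge_min lexx orbT.
  - by rewrite w0 normc0.
have nw : 0 < normc w by rewrite normc_gt0.
have [d d0 dP] := circle_mean_continuous nw ch e0.
pose r' := Num.min (normc w + d / 2) r.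
have wr' : normc w < r' by rewrite lt_min wr andbT; lra.
rewrite -(const r') //; last first.
  by rewrite (lt_trans nw wr') /= /r' ge_min lexx orbT.
have := dP r' (lt_trans nw wr'); rewrite J_eq // subr0; apply.
rewrite gtr0_norm ?subr_gt0 //.
have : r' <= normc w + d / 2 by rewrite /r' ge_min lexx.
lra.
Qed.

(** The means of the kernel are constant on either side of the circle through
    [w] and continuous across it, and they tend to 0 at the origin; hence they all
    vanish. *)
Lemma circle_mean_difference_quotient r : normc w < r ->
  circle_mean (fun z => z * (G z - G w) / (z - w)) r = 0.
Proof.
move=> wr; rewrite -(J0 wr); congr unit_integral; apply/funext => u.
rewrite hE //; apply: contraTneq wr => <-.
by rewrite normc_circle_point -leNgt ler_norm.
Qed.

End Kernel.

Lemma two_expn_neq1 n : (2 ^+ n.+1 : R[i]) != 1.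
Proof.
have H2 : (1 : R) < 2 ^+ n.+1 by rewrite exprn_egt1 // ltr1n.
apply/eqP => /(congr1 (@normc R)); rewrite normcX normc1 normc_nat => E.
by rewrite E ltxx in H2.
Qed.

Lemma one_sub_two_expn_neq0 n : 1 - 2 ^- n.+1 != 0 :> R[i].
Proof. by rewrite subr_eq0 eq_sym invr_eq1 two_expn_neq1. Qed.

(** Doubling the radius multiplies the mean by [2 ^- n.+1] and, by
    differentiability off the origin, leaves it unchanged. *)
Lemma circle_mean_inv_power r n : 0 < r -> circle_mean (fun z => z ^- n.+1) r = 0.
Proof.
move=> r0; pose F (z : R[i]) := z ^- n.+1.
have dF z : z != 0 -> cdiff_at F z.
  move=> z0; apply: cdiffV; first by rewrite expf_neq0.
  by apply: cdiffX; exact: cdiff_id.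
have H : circle_mean F r = circle_mean F (2 * r).
  apply: circle_mean_const => //; first lra.
    by move=> z z0; apply: cdiff_continuous; exact: dF.
  by move=> z /andP[h1 _]; apply: dF; rewrite -normc_gt0; apply: lt_le_trans h1.
have E : circle_mean F (2 * r) = 2 ^- n.+1 * circle_mean F r.
  rewrite /circle_mean -unit_integralZ; last first.
    apply: curve_circle_comp => x; apply: cdiff_continuous; apply: dF.
    exact: circle_point_neq0.
  congr unit_integral; apply/funext => u.
  have -> : circle_point (2 * r) (2 * pi * u) = 2 * circle_point r (2 * pi * u).
    by rewrite circle_pointE rcM [in RHS]circle_pointE mulrA (rmorph_nat (real_complex R)).
  by rewrite /F exprMn invfM.
have := one_sub_two_expn_neq0 n; set a := 2 ^- n.+1 in E * => a1.
apply: (mulfI a1); rewrite mulr0 mulrBl mul1r -E -H.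
exact: subrr.
Qed.

End Cauchy.

Section CauchyFormula.
Context {R : realType}.
Implicit Types (f g h G : R[i] -> R[i]) (z w c : R[i]) (r x y e : R).

Lemma circle_sub_neq0 r x w : normc w < r -> circle_point r x - w != 0.
Proof.
move=> wr; rewrite subr_eq0; apply: contraTneq wr => <-.
by rewrite normc_circle_point -leNgt ler_norm.
Qed.

(** On the circle [z / (z - w)] is the sum of the geometric series in [w / z],
    of which only the constant term has nonzero mean. *)
Lemma circle_mean_geometric w r : normc w < r ->
  circle_mean (fun z => z / (z - w)) r = 1.
Proof.
move=> wr; have r0 := le_lt_trans (normc_ge0 w) wr.
have z0 x := circle_point_neq0 x r0; have zw0 x := circle_sub_neq0 x wr.
pose rho := normc w / r.
have rho01 : 0 <= rho < 1.
  by rewrite /rho divr_ge0 ?normc_ge0 ?ltW //= ltr_pdivrMr // mul1r.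
pose tail n z : R[i] := (w / z) ^+ n * (z / (z - w)).
have ct n : forall x, continuous_at (tail n) (circle_point r x).
  move=> x; apply: cdiff_continuous; apply: cdiffM.
    apply: cdiffX; apply: cdiffM; first exact: cdiff_cst.
    by apply: cdiffV => //; exact: cdiff_id.
  apply: cdiffM; first exact: cdiff_id.
  by apply: cdiffV => //; apply: cdiffB; [exact: cdiff_id|exact: cdiff_cst].
have step n : circle_mean (tail n) r - circle_mean (tail n.+1) r =
    circle_mean (fun z => (w / z) ^+ n) r.
  rewrite /circle_mean -unit_integralB; try exact: curve_circle_comp.
  congr unit_integral; apply/funext => u; rewrite /tail.
  have := z0 (2 * pi * u); have := zw0 (2 * pi * u).
  move: (circle_point r _) => z h1 h2.
  by rewrite exprS -mulrBl; field; rewrite h1 h2.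
have power n : circle_mean (fun z => (w / z) ^+ n.+1) r = 0.
  have -> : circle_mean (fun z => (w / z) ^+ n.+1) r =
     w ^+ n.+1 * circle_mean (fun z => z ^- n.+1) r.
    rewrite /circle_mean -unit_integralZ; last first.
      apply: (curve_circle_comp (h := fun z => z ^- n.+1)) => x.
      apply: cdiff_continuous.
      apply: (cdiffV (f := fun z => z ^+ n.+1)); first by rewrite expf_neq0.
      by apply: cdiffX; exact: cdiff_id.
    by congr unit_integral; apply/funext => u; rewrite exprMn exprVn.
  by rewrite circle_mean_inv_power // mulr0.
have E n : circle_mean (tail 0%N) r - 1 = circle_mean (tail n.+1) r.
  elim: n => [|n IH].
    have := step 0%N; rewrite [X in _ = X](_ : _ = 1).
      by move=> <-; ring.
    by rewrite /circle_mean; under eq_fun do rewrite expr0; exact: unit_integral_cst.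
  by rewrite IH; have := step n.+1; rewrite power => /eqP; rewrite subr_eq0 => /eqP.
have -> : circle_mean (fun z => z / (z - w)) r = circle_mean (tail 0%N) r.
  by congr unit_integral; apply/funext => u; rewrite /tail expr0 mul1r.
apply/eqP; rewrite -subr_eq0; apply/eqP/normc_le0.
have rw0 : 0 < r - normc w by rewrite subr_gt0.
apply: (@geometric_le0 _ _ (rho * (r / (r - normc w))) rho rho01) => n.
rewrite (E n); apply: normc_circle_mean_le => // x.
rewrite /tail !normcM !normcX !normcM !normcV normc_circle_point (gtr0_norm r0).
rewrite -/rho mulrAC [rho * _ ^+ n]mulrC -exprSr.
have rho0 : 0 <= rho by case/andP: rho01.
rewrite ler_wpM2l ?exprn_ge0 // ler_wpM2l ?(ltW r0) //.
rewrite lef_pV2 ?posrE ?normc_gt0 //.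
by have := normc_sub_ge (circle_point r x) w; rewrite normc_circle_point gtr0_norm.
Qed.

(** Multiply [circle_mean_difference_quotient] out and use
    [circle_mean_geometric] for the term with [G w]. *)
Lemma Cauchy_formula G w r : punctured_entire G -> cdiff_at G w -> normc w < r ->
  circle_mean (fun z => G z * (z / (z - w))) r = G w.
Proof.
move=> [dG bG] [c cP] wr; have r0 := le_lt_trans (normc_ge0 w) wr.
have z0 x := circle_point_neq0 x r0; have zw0 x := circle_sub_neq0 x wr.
have H := circle_mean_difference_quotient dG bG cP wr.
have cK : curve (fun u => (fun z => z / (z - w)) (circle_point r (2 * pi * u))).
  apply: (curve_circle_comp (h := fun z => z / (z - w))) => x.
  apply: cdiff_continuous; apply: cdiffM; first exact: cdiff_id.
  by apply: cdiffV => //; apply: cdiffB; [exact: cdiff_id|exact: cdiff_cst].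
have cG : curve (fun u => G (circle_point r (2 * pi * u))).
  by apply: curve_circle_comp => x; apply: cdiff_continuous; exact: dG.
rewrite -[RHS]mulr1 -(circle_mean_geometric wr) /circle_mean.
apply/eqP; rewrite -subr_eq0 -unit_integralZ // -unit_integralB //.
- rewrite -[X in _ == X]H; apply/eqP; congr unit_integral; apply/funext => u.
  by field; exact: zw0.
- exact: curveM.
- by apply: curveM => //; exact: curve_cst.
Qed.

Lemma normc_Cauchy_le G w r B : punctured_entire G -> cdiff_at G w ->
  normc w < r -> (forall x, normc (G (circle_point r x)) <= B) ->
  normc (G w) <= B * (r / (r - normc w)).
Proof.
move=> pG dGw wr GB; have r0 := le_lt_trans (normc_ge0 w) wr.
have z0 x := circle_point_neq0 x r0; have zw0 x := circle_sub_neq0 x wr.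
rewrite -(Cauchy_formula pG dGw wr); apply: normc_circle_mean_le => // x.
  apply: cdiff_continuous; apply: cdiffM; first by apply: pG.1.
  apply: cdiffM; first exact: cdiff_id.
  by apply: cdiffV => //; apply: cdiffB; [exact: cdiff_id|exact: cdiff_cst].
have rw0 : 0 < r - normc w by rewrite subr_gt0.
rewrite !normcM normcV normc_circle_point (gtr0_norm r0).
apply: ler_pM; rewrite ?normc_ge0 //.
  by apply: mulr_ge0; [exact: ltW|rewrite invr_ge0 normc_ge0].
rewrite ler_pM2l // lef_pV2 ?posrE ?normc_gt0 //.
by have := normc_sub_ge (circle_point r x) w; rewrite normc_circle_point gtr0_norm.
Qed.

(** Applied to the powers of [G], the Cauchy estimate loses a constant that does
    not depend on the exponent, hence nothing in the limit. *)
Lemma max_modulus G w r B : punctured_entire G -> cdiff_at G w ->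
  normc w < r -> (forall x, normc (G (circle_point r x)) <= B) ->
  normc (G w) <= B.
Proof.
move=> [dG [C [d [d0 CP]]]] dGw wr GB; have r0 := le_lt_trans (normc_ge0 w) wr.
have B0 : 0 <= B by apply: le_trans (normc_ge0 _) (GB 0).
rewrite leNgt; apply/negP => BG.
have Gw0 : 0 < normc (G w) by apply: le_lt_trans BG.
have : 1 <= 0 :> R; last by rewrite ler10.
apply: (@geometric_le0 _ _ (r / (r - normc w)) (B / normc (G w))).
  by rewrite divr_ge0 ?normc_ge0 //= ltr_pdivrMr // mul1r.
move=> n.
have : normc (G w ^+ n) <= B ^+ n * (r / (r - normc w)).
  apply: (@normc_Cauchy_le (fun z => G z ^+ n)) => //.
  - split; first by move=> z z0; apply: cdiffX; exact: dG.
    exists (`|C| ^+ n), d; split => // z z0 zd; rewrite normcX.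
    apply: lerXn2r; rewrite ?nnegrE ?normc_ge0 ?normr_ge0 //.
    exact: le_trans (CP z z0 zd) (ler_norm _).
  - exact: cdiffX.
  - by move=> x; rewrite normcX lerXn2r // nnegrE ?normc_ge0.
rewrite normcX [B ^+ n * _]mulrC => H.
by rewrite expr_div_n mulrA ler_pdivlMr ?exprn_gt0 // mul1r.
Qed.

Lemma entire_punctured f : (forall z, cdiff_at f z) -> punctured_entire f.
Proof.
move=> df; split => //.
have [d d0 dP] := cdiff_continuous (df 0) ltr01.
exists (normc (f 0) + 1), d; split => // z _; rewrite -[z in normc z]subr0 => /dP.
have := normc_sub_ge (f z) (f 0); lra.
Qed.

Lemma entire_max_modulus f w r B : (forall z, cdiff_at f z) ->
  normc w < r -> (forall x, normc (f (circle_point r x)) <= B) ->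
  normc (f w) <= B.
Proof.
by move=> df wr fB; apply: max_modulus fB => //; exact: entire_punctured.
Qed.

(** The maximum principle applied to [f z / z]. *)
Lemma Schwarz f w r B : (forall z, cdiff_at f z) -> f 0 = 0 ->
  normc w < r -> (forall x, normc (f (circle_point r x)) <= B) ->
  normc (f w) <= normc w / r * B.
Proof.
move=> df f0 wr fB; have r0 := le_lt_trans (normc_ge0 w) wr.
have [->|w0] := eqVneq w 0; first by rewrite f0 normc0 !mul0r.
have nw : 0 < normc w by rewrite normc_gt0.
pose G z := f z / z.
have dG z : z != 0 -> cdiff_at G z.
  by move=> z0; apply: cdiffM => //; apply: cdiffV => //; exact: cdiff_id.
have pG : punctured_entire G.
  split => //; have [c cP] := df 0; have [d d0 dP] := cP 1 ltr01.
  exists (normc c + 1), d; split => // z z0 zd.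
  have := dP z; rewrite subr0 f0 subr0 mul1r => /(_ zd) H.
  have nz : 0 < normc z by rewrite normc_gt0.
  rewrite /G normcM normcV ler_pdivrMr //.
  have := normc_sub_ge (f z) (c * z); rewrite normcM; lra.
have : normc (G w) <= B / r.
  apply: max_modulus pG (dG w w0) wr _ => x.
  rewrite /G normcM normcV normc_circle_point (gtr0_norm r0).
  by rewrite ler_wpM2r // invr_ge0 ltW.
rewrite /G normcM normcV ler_pdivrMr // => H; apply: le_trans H _.
by rewrite le_eqVlt; apply/orP; left; apply/eqP; ring.
Qed.

Lemma periodic_reduce (A : Type) (F : R -> A) (T : R) : 0 < T ->
  (forall x, F (x + T) = F x) -> forall x, exists2 y, 0 <= y < T & F x = F y.
Proof.
move=> T0 FT x.
have Fn y n : F (y + n%:R * T) = F y.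
  elim: n => [|n IH]; first by rewrite mul0r addr0.
  by rewrite -natr1 mulrDl mul1r addrA FT.
pose k := Num.floor (x / T).
exists (x - k%:~R * T).
  rewrite subr_ge0 -ler_pdivlMr // Num.Theory.floor_le /=.
  rewrite ltrBlDl -{2}[T]mul1r -mulrDl -ltr_pdivrMr //.
  by have := Num.Theory.floorD1_gt (x / T); rewrite intrD.
case: k => n.
  by rewrite -[in LHS](subrK (n%:R * T) x) Fn.
by rewrite NegzE mulrNz mulNr opprK -[LHS](Fn _ n.+1).
Qed.

Lemma circle_bounded f r : (forall x, continuous_at f (circle_point r x)) ->
  exists M, forall x, normc (f (circle_point r x)) <= M.
Proof.
move=> cf.
have /curve_normc c := curve_circle_comp cf.
have [u _ uM] := EVT_max ler01 (continuous_subspaceT c).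
exists (normc (f (circle_point r (2 * pi * u)))) => x.
have pi0 : 0 < 2 * pi :> R by rewrite mulr_gt0 ?pi_gt0.
have [y /andP[y0 y1] ->] := periodic_reduce pi0
  (fun x => congr1 (fun z => normc (f z)) (circle_point_2pi r x)) x.
have := uM (y / (2 * pi)); rewrite [2 * pi * (_ / _)]mulrC divfK ?gt_eqF //; apply.
by rewrite in_itv /= divr_ge0 ?(ltW pi0) //= ler_pdivrMr // mul1r ltW.
Qed.

(** The remainder is the Cauchy integral of [f] against
    [v ^ 2 / ((z - w - v) * (z - w) ^ 2)]. *)
Lemma taylor2 f rho : (forall z, cdiff_at f z) -> 0 <= rho ->
  exists f1 : R[i] -> R[i], exists C : R, forall w v,
    normc w <= rho -> normc v <= 1 ->
    normc (f (w + v) - f w - v * f1 w) <= C * normc v ^+ 2.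
Proof.
move=> df rho0; pose r := rho + 2; have r0 : 0 < r by rewrite /r; lra.
have [M MP] : exists M, forall x, normc (f (circle_point r x)) <= M.
  by apply: circle_bounded => x; exact: cdiff_continuous.
pose K w z := f z * (z / (z - w)).
have cK w : normc w < r -> forall x, continuous_at (K w) (circle_point r x).
  move=> wr x; apply: cdiff_continuous; apply: cdiffM => //.
  apply: cdiffM; first exact: cdiff_id.
  by apply: cdiffV; [exact: circle_sub_neq0|apply: cdiffB; [exact: cdiff_id|exact: cdiff_cst]].
pose f1 w := circle_mean (fun z => K w z / (z - w)) r.
exists f1, (M * r); move=> w v wrho v1.
have wr : normc w < r by rewrite /r; lra.
have whr : normc (w + v) < r.
  by apply: le_lt_trans (normcD_le _ _) _; rewrite /r; lra.
have cK1 : forall x, continuous_at (fun z => K w z / (z - w)) (circle_point r x).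
  move=> x; apply: cdiff_continuous; apply: cdiffM.
    apply: cdiffM => //; apply: cdiffM; first exact: cdiff_id.
    by apply: cdiffV; [exact: circle_sub_neq0|apply: cdiffB; [exact: cdiff_id|exact: cdiff_cst]].
  by apply: cdiffV; [exact: circle_sub_neq0|apply: cdiffB; [exact: cdiff_id|exact: cdiff_cst]].
have pf := entire_punctured df.
rewrite -(Cauchy_formula pf (df _) wr) -(Cauchy_formula pf (df _) whr) /f1.
have k1 : curve (fun u => K w (circle_point r (2 * pi * u))).
  exact: curve_circle_comp (cK _ wr).
have k2 : curve (fun u => K (w + v) (circle_point r (2 * pi * u))).
  exact: curve_circle_comp (cK _ whr).
have k3 := curve_circle_comp cK1.
have k4 := curveM (curve_cst v) k3.
have k1' := curveM (curve_cst (-1)) k1.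
have k4' := curveM (curve_cst (-1)) k4.
rewrite /circle_mean -unit_integralB // -unit_integralZ // -unit_integralB //; last first.
  have := curveD k2 k1'; by under eq_fun do rewrite mulN1r.
apply: normc_unit_integral_le.
  have := curveD (curveD k2 k1') k4'.
  by under eq_fun do rewrite !mulN1r.
move=> u _; rewrite /K.
have z1 := circle_sub_neq0 (2 * pi * u) wr.
have z2 := circle_sub_neq0 (2 * pi * u) whr.
have nz : normc (circle_point r (2 * pi * u)) = r.
  by rewrite normc_circle_point gtr0_norm.
have fM := MP (2 * pi * u).
move: (circle_point r (2 * pi * u)) z1 z2 nz fM => z z1 z2 nz fM.
have -> : f z * (z / (z - (w + v))) - f z * (z / (z - w)) -
  v * (f z * (z / (z - w)) / (z - w)) =
  f z * z * v ^+ 2 * ((z - (w + v)) * ((z - w) * (z - w)))^-1.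
  by field; rewrite z1 z2.
rewrite !normcM normcV !normcM nz -[normc v * _]expr2.
have M0 : 0 <= M := le_trans (normc_ge0 _) fM.
have a1 : 1 <= normc (z - (w + v)).
  have := normc_sub_ge z (w + v); have := normcD_le w v; rewrite nz /r; lra.
have a2 : 1 <= normc (z - w).
  have := normc_sub_ge z w; rewrite nz /r; lra.
have a3 : 1 <= normc (z - (w + v)) * (normc (z - w) * normc (z - w)).
  by rewrite !mulr_ege1.
rewrite ler_pdivrMr; last by apply: lt_le_trans a3.
have h20 : 0 <= normc v ^+ 2 by rewrite exprn_ge0 // normc_ge0.
apply: (@le_trans _ _ (M * r * normc v ^+ 2)).
  by rewrite ler_wpM2r // ler_wpM2r // ltW.
apply: ler_peMr => //; apply: mulr_ge0 => //; apply: mulr_ge0 => //.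
exact: ltW.
Qed.

End CauchyFormula.

(** * Second-order expansion of entire functions *)

Section Derivative.
Context {R : realType}.
Implicit Types (f : R[i] -> R[i]) (z w v : R[i]).

(** Applying the expansion at [w] and at [z] to the same increment shows that
    the derivative is locally Lipschitz, hence continuous. *)
Lemma entire_derivative f : (forall z, cdiff_at f z) ->
  exists2 f' : R[i] -> R[i], (forall w, continuous_at f' w) &
  forall rho, 0 <= rho -> exists C : R, forall w v,
    normc w <= rho -> normc v <= 1 ->
    normc (f (w + v) - f w - v * f' w) <= C * normc v ^+ 2.
Proof.
move=> df; have /choice[f' f'P] := df.
have quad rho : 0 <= rho -> exists C : R, forall w v,
    normc w <= rho -> normc v <= 1 ->
    normc (f (w + v) - f w - v * f' w) <= C * normc v ^+ 2.
  move=> rho0; have [f1 [C CP]] := taylor2 df rho0; exists C => w v wrho v1.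
  suff -> : f' w = f1 w by exact: CP.
  apply/eqP; rewrite -subr_eq0; apply/eqP/normc_le0/le_all_eps => e e0.
  have e20 : 0 < e / 2 by rewrite divr_gt0.
  have C10 : 0 < `|C| + 1 by rewrite ltr_wpDl.
  have [d d0 dP] := f'P w _ e20.
  pose x := Num.min (Num.min 1 (d / 2)) (e / 2 / (`|C| + 1)).
  have x0 : 0 < x by rewrite !lt_min ltr01 !divr_gt0.
  have x1 : x <= 1 by rewrite /x !ge_min lexx.
  have xd : x < d.
    have : x <= d / 2 by rewrite /x !ge_min lexx orbT.
    lra.
  have xe : x * (`|C| + 1) <= e / 2.
    by rewrite -ler_pdivlMr // /x ge_min lexx orbT.
  have nx : normc (x%:C : R[i]) = x by rewrite normc_real gtr0_norm.
  have := CP w x%:C wrho; rewrite nx => /(_ x1) h1.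
  have := dP (w + x%:C); rewrite addrAC subrr add0r nx => /(_ xd) h2.
  rewrite -(ler_pM2l x0) -[X in X * _ <= _]nx -normcM.
  have -> : x%:C * (f' w - f1 w) =
    (f (w + x%:C) - f w - x%:C * f1 w) - (f (w + x%:C) - f w - f' w * x%:C)
    by ring.
  apply: le_trans (normcB_le _ _) _; apply: le_trans (lerD h1 h2) _.
  have h3 : C * x ^+ 2 <= x * (x * (`|C| + 1)).
    rewrite expr2 mulrC -mulrA; apply: ler_wpM2l; first exact: ltW.
    apply: ler_wpM2l; first exact: ltW.
    have := ler_norm C; lra.
  have := ler_wpM2l (ltW x0) xe; lra.
exists f' => // w e e0.
have [C CP] := quad (normc w + 1) (addr_ge0 (normc_ge0 _) ler01).
have C10 : 0 < 2 * `|C| + 1 by rewrite ltr_wpDl // mulr_ge0.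
exists (Num.min 1 (e / (2 * `|C| + 1))); first by rewrite lt_min ltr01 divr_gt0.
move=> z; rewrite lt_min => /andP[zw1]; rewrite ltr_pdivlMr // => zwe.
have [->|zw] := eqVneq z w; first by rewrite subrr normc0 ltW.
have nz0 : 0 < normc (z - w) by rewrite normc_gt0 subr_eq0.
have h1 := CP w (z - w) ltac:(by rewrite lerDl) (ltW zw1).
have zr : normc z <= normc w + 1 by have := normc_sub_ge z w; lra.
have h2 := CP z (w - z) zr; rewrite normc_distC in h2.
have {}h2 := h2 (ltW zw1).
rewrite -(ler_pM2l nz0) -normcM.
have -> : (z - w) * (f' z - f' w) =
   (f (w + (z - w)) - f w - (z - w) * f' w) +
   (f (z + (w - z)) - f z - (w - z) * f' z).
  have -> : w + (z - w) = z by ring.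
  have -> : z + (w - z) = w by ring.
  by ring.
apply: le_trans (normcD_le _ _) _; apply: le_trans (lerD h1 h2) _.
have h3 : C * normc (z - w) ^+ 2 <= `|C| * normc (z - w) ^+ 2.
  by rewrite ler_wpM2r ?exprn_ge0 ?normc_ge0 // ler_norm.
apply: le_trans (lerD h3 h3) _; rewrite expr2.
have := ler_wpM2l (ltW nz0) (ltW zwe).
have := mulr_ge0 (ltW nz0) (ltW nz0); lra.
Qed.

End Derivative.

(** * The Hausdorff operator on entire functions *)

Section Hausdorff.
Context {R : realType}.
Variable mu : {measure set (measurableTypeR R) -> \bar R}.
Hypothesis hmu : mu `]0%R, 1%R]%classic = 0%E.
Implicit Types (f g : R[i] -> R[i]) (z w : R[i]).

Notation D := (`]0%R, +oo[%classic : set (measurableTypeR R)).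
Notation E := (`]1%R, +oo[%classic : set (measurableTypeR R)).

Hypothesis mass_finite : mu.-integrable E (fun t => (t^-1)%:E).

Definition moment (n : nat) : R := \int[mu]_(t in E) (t^-1 ^+ n.+1).

Let DE : D `\` `]0%R, 1%R]%classic = E.
Proof.
apply/seteqP; split => t /=; rewrite !in_itv /= !andbT.
  by move=> [t0] /negP; rewrite t0 /= -ltNge.
by move=> t1; split; [lra|apply/negP; rewrite negb_and -ltNge t1 orbT].
Qed.

Lemma measurable_inv : measurable_fun D (fun t : R => t^-1).
Proof.
apply: open_continuous_measurable_fun; first exact: interval_open.
by move=> t; rewrite inE /= in_itv /= andbT => t0; apply: inv_continuous; rewrite gt_eqF.
Qed.

Lemma subset_tail : E `<=` D.
Proof. by move=> t; rewrite /= !in_itv /= !andbT; lra. Qed.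

Let inv01 t : E t -> 0 < t^-1 < 1.
Proof.
rewrite /= in_itv /= andbT => t1; have t0 : 0 < t by lra.
by rewrite invr_gt0 t0 invf_lt1.
Qed.

(** The integrands of interest are continuous functions of [s = t^-1] on the whole
    line, which gives measurability; the null set [t <= 1] is then discarded. *)
Lemma integrable_inv_comp (F : R -> R) (M : R) : continuous F ->
  (forall t, E t -> `|F t^-1| <= M * t^-1) ->
  mu.-integrable D (fun t => (F t^-1)%:E) /\ mu.-integrable E (fun t => (F t^-1)%:E).
Proof.
move=> cF FM.
have mF : measurable_fun D (fun t => (F t^-1)%:E).
  apply/measurable_EFinP; apply: (measurableT_comp _ measurable_inv).
  exact: continuous_measurable_fun.
have iE : mu.-integrable E (fun t => (F t^-1)%:E).
  apply: (le_integrable _ _ _ (integrableZl _ M mass_finite)) => //.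
    by apply: measurable_funS mF => //; exact: subset_tail.
  move=> t Et; rewrite -EFinM lee_fin; apply: le_trans (FM t Et) _.
  exact: ler_norm.
split => //; apply/(negligible_integrable _ _ mF hmu) => //.
by rewrite DE.
Qed.

Lemma Rintegral_inv_comp (F : R -> R) :
  mu.-integrable D (fun t => (F t^-1)%:E) ->
  \int[mu]_(t in D) F t^-1 = \int[mu]_(t in E) F t^-1.
Proof.
by move=> iF; rewrite /Rintegral (negligible_integral _ _ iF hmu) // DE.
Qed.

Lemma cintegrable_inv_comp (phi : R -> R[i]) (M : R) : curve phi ->
  (forall t, E t -> normc (phi t^-1) <= M * t^-1) ->
  [/\ cintegrable mu D (fun t => phi t^-1), cintegrable mu E (fun t => phi t^-1)
    & cintegral mu D (fun t => phi t^-1) = cintegral mu E (fun t => phi t^-1)].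
Proof.
move=> cphi phiM.
have [r1 r2] := @integrable_inv_comp (fun s => complex.Re (phi s)) M (curve_Re cphi)
  (fun t Et => le_trans (Re_le_normc _) (phiM t Et)).
have [i1 i2] := @integrable_inv_comp (fun s => complex.Im (phi s)) M (curve_Im cphi)
  (fun t Et => le_trans (Im_le_normc _) (phiM t Et)).
split => //; congr Complex.
  exact: (Rintegral_inv_comp (F := fun s => complex.Re (phi s))).
exact: (Rintegral_inv_comp (F := fun s => complex.Im (phi s))).
Qed.

Lemma moment_integrable n :
  mu.-integrable E (fun t => (t^-1 ^+ n.+1)%:E).
Proof.
have [] // := @integrable_inv_comp (fun s => s ^+ n.+1) 1.
  by move=> x; exact: exprn_continuous.
move=> t /inv01/andP[t0 t1]; rewrite mul1r ger0_norm ?exprn_ge0 ?(ltW t0) // exprS.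
by apply: ler_piMr; [exact: ltW|rewrite exprn_ile1 // ltW].
Qed.

Lemma curve_id_real : curve (fun s : R => s%:C).
Proof. by have := @curve_real R 0 1; under eq_fun do rewrite add0r mul1r. Qed.

Lemma hausdorff_integrandE f z t :
  hausdorff_integrand f z t = (fun s : R => s%:C * f (z * s%:C)) t^-1.
Proof. by rewrite /hausdorff_integrand rcV. Qed.

Lemma curve_hausdorff f z : (forall w, continuous_at f w) ->
  curve (fun s : R => s%:C * f (z * s%:C)).
Proof.
move=> cf; apply: curveM; first exact: curve_id_real.
apply: (@curve_comp _ f) => //; apply: curveM; first exact: curve_cst.
exact: curve_id_real.
Qed.

Lemma normc_inv (t : R) : E t -> normc (t^-1%:C : R[i]) = t^-1.
Proof. by move=> /inv01/andP[t0 _]; rewrite normc_real gtr0_norm. Qed.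

Lemma hausdorff_integrand_bound f z B : (forall t, E t -> normc (f (z * t^-1%:C)) <= B) ->
  forall t, E t -> normc ((fun s : R => s%:C * f (z * s%:C)) t^-1) <= B * t^-1.
Proof.
move=> fB t Et; rewrite normcM normc_inv // mulrC ler_wpM2r ?fB //.
by have /andP[/ltW] := inv01 Et.
Qed.

Lemma hausdorff_cintegrable f z : (forall w, cdiff_at f w) ->
  [/\ cintegrable mu D (hausdorff_integrand f z),
      cintegrable mu E (hausdorff_integrand f z)
    & hausdorff mu f z = cintegral mu E (hausdorff_integrand f z)].
Proof.
move=> df; have cf w := cdiff_continuous (df w).
have [M MP] := @circle_bounded R f (normc z + 1) (fun x => cf _).
rewrite /hausdorff (_ : hausdorff_integrand f z =
  (fun t => (fun s : R => s%:C * f (z * s%:C)) t^-1)); last first.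
  by apply/funext => t; rewrite hausdorff_integrandE.
apply: (@cintegrable_inv_comp (fun s : R => s%:C * f (z * s%:C)) M).
  exact: curve_hausdorff.
move=> t0 Et0; apply: (@hausdorff_integrand_bound f z M _ t0 Et0) => t Et.
apply: (entire_max_modulus df) MP; rewrite normcM normc_inv //.
have /andP[_ t1] := inv01 Et.
by have := ler_wpM2l (normc_ge0 z) (ltW t1); lra.
Qed.

Lemma normc_hausdorff_le f z n B : (forall w, cdiff_at f w) ->
  (forall t, E t -> normc (f (z * t^-1%:C)) <= t^-1 ^+ n * B) ->
  normc (hausdorff mu f z) <= moment n * B.
Proof.
move=> df fB; have [_ iE ->] := hausdorff_cintegrable z df.
rewrite mulrC /moment -RintegralZl //; last exact: moment_integrable.
apply: normc_cintegral_le => //.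
  exact: (integrableZl _ B (moment_integrable n)).
move=> t Et; rewrite hausdorff_integrandE normcM normc_inv //.
have /andP[/ltW t0 _] := inv01 Et.
by apply: le_trans (ler_wpM2l t0 (fB t Et)) _; rewrite exprS mulrA [B * _]mulrC.
Qed.

Lemma hausdorffMD a f g : (forall w, cdiff_at f w) -> (forall w, cdiff_at g w) ->
  hausdorff mu (fun z => a * f z + g z) = (fun z => a * hausdorff mu f z + hausdorff mu g z).
Proof.
move=> df dg; apply/funext => z.
have [fi _ _] := hausdorff_cintegrable z df.
have [gi _ _] := hausdorff_cintegrable z dg.
rewrite /hausdorff -cintegralMD //; apply: eq_cintegral => t _.
by rewrite /hausdorff_integrand; ring.
Qed.

Lemma hausdorff_rot c f : hausdorff mu (fun z => f (c * z)) = (fun z => hausdorff mu f (c * z)).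
Proof.
apply/funext => z; apply: eq_cintegral => t _.
by rewrite /hausdorff_integrand mulrA.
Qed.

(** Differentiate under the integral: the error of the first-order expansion of
    [f] at [z / t] is at most [C * (normc (w - z) / t) ^ 2], which is integrable
    against [1 / t]. *)
Lemma hausdorff_entire f : (forall w, cdiff_at f w) ->
  forall z, cdiff_at (hausdorff mu f) z.
Proof.
move=> df z; have [f' cf' quad] := entire_derivative df.
have [C CP] := quad (normc z) (normc_ge0 z).
pose psi (s : R) := s%:C * (s%:C * f' (z * s%:C)).
have cpsi : curve psi.
  by apply: curveM; [exact: curve_id_real|exact: curve_hausdorff].
have [M MP] : exists M, forall s : R, 0 <= s <= 1 -> normc (f' (z * s%:C)) <= M.
  have c : curve (fun s : R => f' (z * s%:C)).
    apply: (@curve_comp _ f') => //.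
    by apply: curveM; [exact: curve_cst|exact: curve_id_real].
  have [u _ uM] := EVT_max ler01 (continuous_subspaceT (curve_normc c)).
  by exists (normc (f' (z * u%:C))) => s s01; apply: uM; rewrite in_itv.
have [_ iE _] : [/\ cintegrable mu D (fun t => psi t^-1), cintegrable mu E (fun t => psi t^-1)
    & cintegral mu D (fun t => psi t^-1) = cintegral mu E (fun t => psi t^-1)].
  apply: (@cintegrable_inv_comp psi M) => // t Et.
  have /andP[t0 t1] := inv01 Et.
  rewrite /psi !normcM normc_inv // [_ * _ in X in _ <= X]mulrC.
  rewrite ler_wpM2l ?(ltW t0) //.
  have h : normc (f' (z * t^-1%:C)) <= M by apply: MP; rewrite !ltW.
  apply: (le_trans _ h); apply: ler_piMl; [exact: normc_ge0|exact: ltW].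
exists (cintegral mu E (fun t => psi t^-1)) => e e0.
have m0 : 0 <= moment 2.
  by apply: Rintegral_ge0 => t /inv01/andP[t0 _]; rewrite exprn_ge0 // ltW.
have K0 : 0 < moment 2 * `|C| + 1 by rewrite ltr_wpDl // mulr_ge0.
exists (Num.min 1 (e / (moment 2 * `|C| + 1))).
  by rewrite lt_min ltr01 divr_gt0.
move=> w; rewrite lt_min => /andP[wz1]; rewrite ltr_pdivlMr // => wze.
have [_ i1 ->] := hausdorff_cintegrable w df.
have [_ i2 ->] := hausdorff_cintegrable z df.
set J1 := cintegral _ _ _; set J2 := cintegral _ _ _; set J3 := cintegral _ _ _.
have -> : J1 - J2 - J3 * (w - z) = (z - w) * J3 + ((-1) * J2 + J1) by ring.
rewrite /J1 /J2 /J3 -!cintegralMD //; last exact: cintegrableMD.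
pose G (t : R) := `|C| * normc (w - z) ^+ 2 * t^-1 ^+ 3.
apply: (@le_trans _ _ (\int[mu]_(t in E) G t)).
  apply: normc_cintegral_le => //.
  - by do 2 apply: cintegrableMD => //.
  - exact: (integrableZl _ _ (moment_integrable 2)).
  move=> t Et; have /andP[t0 t1] := inv01 Et.
  rewrite /psi /G !hausdorff_integrandE.
  have q := CP (z * t^-1%:C) ((w - z) * t^-1%:C).
  have -> : (z - w) * (t^-1%:C * (t^-1%:C * f' (z * t^-1%:C))) +
    (-1 * (t^-1%:C * f (z * t^-1%:C)) + t^-1%:C * f (w * t^-1%:C)) =
    t^-1%:C * (f (z * t^-1%:C + (w - z) * t^-1%:C) - f (z * t^-1%:C) -
     ((w - z) * t^-1%:C) * f' (z * t^-1%:C)).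
    have -> : z * t^-1%:C + (w - z) * t^-1%:C = w * t^-1%:C by ring.
    by ring.
  rewrite normcM normc_inv //.
  have q1 : normc (z * t^-1%:C) <= normc z.
    by rewrite normcM normc_inv // ler_piMr ?normc_ge0 // ltW.
  have q2 : normc ((w - z) * t^-1%:C) <= 1.
    rewrite normcM normc_inv // -[leRHS]mulr1.
    by rewrite ler_pM ?normc_ge0 // ltW.
  apply: le_trans (ler_wpM2l (ltW t0) (q q1 q2)) _.
  rewrite normcM normc_inv // exprMn [t^-1 ^+ 3]exprS.
  have -> : t^-1 * (C * (normc (w - z) ^+ 2 * t^-1 ^+ 2)) =
    C * (normc (w - z) ^+ 2 * (t^-1 * t^-1 ^+ 2)) by ring.
  rewrite -[leRHS]mulrA; apply: ler_wpM2r (ler_norm C).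
  by rewrite !mulr_ge0 ?exprn_ge0 ?normc_ge0 // ltW.
rewrite RintegralZl //; last exact: moment_integrable.
rewrite -/(moment 2).
have n0 := normc_ge0 (w - z).
have h1 := ler_wpM2l n0 (ltW wze).
have h2 := mulr_ge0 n0 n0.
rewrite expr2 [e * _]mulrC; apply: le_trans h1.
by lra.
Qed.

Lemma hausdorff_at0 f : (forall w, cdiff_at f w) ->
  hausdorff mu f 0 = (moment 0)%:C * f 0.
Proof.
move=> df; have [_ _ ->] := hausdorff_cintegrable 0 df.
have i0 : cintegrable mu E (fun t : R => (t^-1)%:C).
  by split => /=; [exact: mass_finite|exact: integrable0].
transitivity (cintegral mu E (fun t : R => f 0 * t^-1%:C)).
  by apply: eq_cintegral => t _; rewrite hausdorff_integrandE /= mul0r mulrC.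
rewrite cintegralZ // mulrC; congr (_ * _).
rewrite /cintegral /=; congr Complex.
by rewrite /Rintegral integral0.
Qed.

(** For [t > 1] the point [z / t] lies inside the circle through [z]. *)
Lemma hausdorff_sup_le f r B : (forall w, cdiff_at f w) -> 0 <= r ->
  (forall x, normc (f (circle_point r x)) <= B) ->
  forall z, normc z = r -> normc (hausdorff mu f z) <= moment 0 * B.
Proof.
move=> df r0 fB z zr; apply: normc_hausdorff_le => // t Et; rewrite expr0 mul1r.
have [r_eq0|rn0] := eqVneq r 0.
  rewrite (normc_le0 (_ : normc z <= 0)) ?zr ?r_eq0 // mul0r.
  by have := fB 0; rewrite r_eq0 circle_point0.
apply: (entire_max_modulus df) fB; rewrite normcM normc_inv // zr.
have /andP[t0 t1] := inv01 Et.
by rewrite gtr_pMr // lt_def rn0.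
Qed.

(** Schwarz's lemma at [z / t] contributes a second factor [1 / t]. *)
Lemma hausdorff_sup_le0 f r B : (forall w, cdiff_at f w) -> f 0 = 0 -> 0 <= r ->
  (forall x, normc (f (circle_point r x)) <= B) ->
  forall z, normc z = r -> normc (hausdorff mu f z) <= moment 1 * B.
Proof.
move=> df f0 r0 fB z zr; apply: normc_hausdorff_le => // t Et; rewrite expr1.
have B0 : 0 <= B by apply: le_trans (normc_ge0 _) (fB 0).
have /andP[t0 t1] := inv01 Et.
have [r_eq0|rn0] := eqVneq r 0.
  rewrite (normc_le0 (_ : normc z <= 0)) ?zr ?r_eq0 // mul0r f0 normc0.
  by rewrite mulr_ge0 // ltW.
have rp : 0 < r by rewrite lt_def rn0.
have zt : normc (z * t^-1%:C) = r * t^-1 by rewrite normcM normc_inv // zr.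
have := Schwarz df f0 (_ : normc (z * t^-1%:C) < r) fB.
rewrite zt [r * _]mulrC mulfK //; apply.
by rewrite gtr_pMl.
Qed.

Lemma moment_ge0 n : 0 <= moment n.
Proof.
by apply: Rintegral_ge0 => t /inv01/andP[t0 _]; rewrite exprn_ge0 // ltW.
Qed.

(** Equality of the two moments would put all the mass at [t = 1], outside the
    domain of integration. *)
Lemma moment1_lt : moment 0 = 1 -> moment 1 < 1.
Proof.
move=> m1; rewrite -m1 lt_neqAle; apply/andP; split; last first.
  apply: (le_Rintegral _ (moment_integrable 1) (moment_integrable 0)) => //.
  by move=> t /inv01/andP[t0 t1]; rewrite exprS ler_piMl ?expr1 ?ltW.
apply/eqP => m10.
pose g t : R := t^-1 ^+ 1 - t^-1 ^+ 2.
have gi : mu.-integrable E (EFin \o g).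
  exact: (integrableB _ (moment_integrable 0) (moment_integrable 1)).
have g0 t : E t -> 0 < g t.
  move=> /inv01/andP[t0 t1]; by rewrite /g expr1 expr2 subr_gt0 gtr_pMr.
have : \int[mu]_(t in E) g t = 0.
  rewrite (RintegralB _ (moment_integrable 0) (moment_integrable 1)) //.
  by rewrite -/(moment 0) -/(moment 1) m10 subrr.
rewrite /Rintegral => /eqP; rewrite fine_eq0; last exact: integrable_fin_num.
move=> /eqP ig0.
have /(ae_eq_integral_abs _ _ _).1 : (\int[mu]_(t in E) `|(g t)%:E| = 0)%E.
  rewrite -[RHS]ig0; apply: eq_integral => t /set_mem Et.
  by rewrite gee0_abs // lee_fin ltW // g0.
move=> /(_ (measurable_itv _)) /(_ (measurable_int _ gi)).
move=> [N [mN N0 EN]].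
have muE : mu E = 0%E.
  apply/eqP; rewrite -measure_le0 -N0; apply: le_measure; rewrite ?inE //.
  move=> t Et; apply: EN => /= /(_ Et) [] /eqP; rewrite gt_eqF //; exact: g0.
have : moment 0 = 0.
  rewrite /moment /Rintegral.
  have := @integral_abs_eq0 _ _ _ mu E (fun t => (t^-1 ^+ 1)%:E) (measurable_itv _)
    (measurable_int _ (moment_integrable 0)) muE.
  under eq_integral => t /set_mem Et.
    rewrite gee0_abs; last first.
      by have /andP[t0 _] := inv01 Et; rewrite lee_fin expr1 ltW.
    over.
  by move=> ->.
by rewrite m1 => /eqP; rewrite oner_eq0.
Qed.

End Hausdorff.

(** * Means over regular polygons *)

Section PowerMeans.
Context {R : realType}.
Notation leb := (@lebesgue_measure R).
Implicit Types (u : R -> R) (x y a b p : R) (m : nat).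

Lemma powR_continuous_nneg p x e : 1 <= p -> 0 <= x -> 0 < e ->
  exists2 d, 0 < d & forall y, 0 <= y -> `|y - x| < d ->
    `|y `^ p - x `^ p| <= e.
Proof.
move=> p1 x0 e0; have p0 : p != 0 by rewrite gt_eqF //; lra.
have [->|xn0] := eqVneq x 0.
  exists (Num.min 1 e); first by rewrite lt_min ltr01.
  move=> y y0; rewrite subr0 lt_min ger0_norm // => /andP[y1 ye].
  rewrite powR0 // subr0 ger0_norm ?powR_ge0 //.
  have [->|yn0] := eqVneq y 0; first by rewrite powR0 // ltW.
  apply: le_trans (ltW ye); apply: ge1r_powR => //.
  by rewrite lt_def yn0 y0 ltW.
have xp : 0 < x by rewrite lt_def xn0.
have dx : derivable ((fun y => y `^ p) : R^o -> R^o) x 1.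
  by apply: derivable_powR; rewrite in_itv /= xp.
have /derivable1_diffP/differentiable_continuous/cvgrPdist_le/(_ e e0) := dx.
move=> /nbhs_ballP[d /= d0 dP]; exists d => // y _ yx.
by rewrite distrC; apply: dP; rewrite /ball /= distrC.
Qed.

Lemma Young_powR a b p : 1 <= p -> 0 <= a -> 0 <= b ->
  a `^ (p - 1) * b <= (1 - p^-1) * a `^ p + p^-1 * b `^ p.
Proof.
move=> p1 a0 b0; have p0 : 0 < p by lra.
have [->|pn1] := eqVneq p 1.
  by rewrite subrr invr1 subrr mul0r add0r mul1r powRr0 mul1r powRr1.
have q0 : 0 < p - 1 by rewrite subr_gt0 lt_def pn1.
have := @conjugate_powR R (a `^ (p - 1)) b (p / (p - 1)) p.
rewrite powR_ge0 b0 divr_gt0 // p0 invf_div => /(_ isT isT isT isT) H.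
have {}H := H ltac:(by field; rewrite !gt_eqF).
apply: le_trans H _; rewrite -powRrM.
have -> : (p - 1) * (p / (p - 1)) = p by field; rewrite gt_eqF.
by rewrite le_eqVlt; apply/orP; left; apply/eqP; field; rewrite !gt_eqF.
Qed.

Definition dyadic_step m : R := 2 * pi / 2 ^+ m.

(** [dyadic_mean m u x] averages [u] over the [2 ^ m] vertices of the regular
    polygon with a vertex at angle [x]. *)
Fixpoint dyadic_mean m u x : R :=
  if m is m'.+1 then
    2^-1 * (dyadic_mean m' u x + dyadic_mean m' u (x + dyadic_step m))
  else u x.

Lemma dyadic_stepS m : dyadic_step m = dyadic_step m.+1 + dyadic_step m.+1.
Proof. by rewrite /dyadic_step exprS; field; rewrite expf_neq0. Qed.

Lemma dyadic_step_gt0 m : 0 < dyadic_step m.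
Proof. by rewrite divr_gt0 ?exprn_gt0 // mulr_gt0 ?pi_gt0. Qed.

Lemma dyadic_step_small e : 0 < e -> exists m, dyadic_step m < e.
Proof.
move=> e0; have pi0 := pi_gt0 R.
have H : 2 * pi / e < (Num.bound (2 * pi / e))%:R.
  by apply: Num.Theory.archi_boundP; rewrite divr_ge0 ?mulr_ge0 // ltW.
exists (Num.bound (2 * pi / e)); rewrite /dyadic_step.
rewrite ltr_pdivrMr ?exprn_gt0 // [e * _]mulrC -ltr_pdivrMr //; apply: lt_trans H _.
by rewrite -natrX ltr_nat ltn_expl.
Qed.

(** The vertices depend neither on [u] nor on [x], so the polygon means of a
    function and of its image under an operator involve the same rotations. *)
Lemma dyadic_mean_sum m : exists s : seq R,
  forall u x, dyadic_mean m u x = 2 ^- m * \sum_(a <- s) u (x + a).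
Proof.
elim: m => [|m [s IH]].
  by exists [:: 0] => u x; rewrite big_seq1 addr0 expr0 invr1 mul1r.
exists (s ++ [seq a + dyadic_step m.+1 | a <- s]) => u x.
rewrite big_cat big_map /= !IH -mulrDr mulrA.
have -> : 2^-1 * 2 ^- m = 2 ^- m.+1 :> R by rewrite exprS invfM.
congr (_ * (_ + _)).
by apply: eq_bigr => a _; rewrite -addrA [dyadic_step _ + _]addrC.
Qed.

Lemma dyadic_mean_periodic m u : (forall x, u (x + 2 * pi) = u x) ->
  forall x, dyadic_mean m u (x + dyadic_step m) = dyadic_mean m u x.
Proof.
move=> pu; elim: m => [|m IH] x; first by rewrite /dyadic_step expr0 divr1 /= pu.
rewrite /= addrC -addrA -dyadic_stepS IH; congr (_ * _).
Qed.

Lemma dyadic_mean_uniform m u d e : (forall x y, `|x - y| < d -> `|u x - u y| <= e) ->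
  forall x y, `|x - y| < d -> `|dyadic_mean m u x - dyadic_mean m u y| <= e.
Proof.
move=> H; elim: m => [//|m IH] x y xy /=.
have h1 := IH _ _ xy.
have h2 : `|dyadic_mean m u (x + dyadic_step m.+1) -
           dyadic_mean m u (y + dyadic_step m.+1)| <= e.
  by apply: IH; rewrite opprD addrACA subrr addr0.
rewrite -mulrBr opprD addrACA normrM ger0_norm ?invr_ge0 //.
by have := ler_normD (dyadic_mean m u x - dyadic_mean m u y)
  (dyadic_mean m u (x + dyadic_step m.+1) - dyadic_mean m u (y + dyadic_step m.+1)); lra.
Qed.

Lemma continuous_affine_comp u a b : continuous u -> continuous (fun x => u (a + b * x)).
Proof.
move=> cu x; apply: (@continuous_comp _ _ _ (fun x => a + b * x) u); last exact: cu.
apply: (@continuousD _ R^o); first exact: cst_continuous.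
exact: mulrl_continuous.
Qed.

Lemma dyadic_mean_continuous m u : continuous u -> continuous (dyadic_mean m u).
Proof.
move=> cu; elim: m => [//|m IH] /= x.
apply: cvgM; first exact: cvg_cst.
apply: cvgD; first exact: IH.
have := @continuous_affine_comp _ (dyadic_step m.+1) 1 IH x.
by under eq_fun do rewrite mul1r addrC.
Qed.

(** Each halving of the interval of integration doubles the number of vertices. *)
Lemma Rintegral_dyadic_mean m u : continuous u ->
  \int[leb]_(v in `[0, 1]) u (2 * pi * v) =
  \int[leb]_(v in `[0, 1]) dyadic_mean m u (dyadic_step m * v).
Proof.
move=> cu; have c k b : continuous (fun v => dyadic_mean k u (b * v)).
  have := @continuous_affine_comp _ 0 b (@dyadic_mean_continuous k u cu).
  by under eq_fun do rewrite add0r.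
elim: m => [|m ->].
  by apply: eq_Rintegral => v _; rewrite /dyadic_step expr0 divr1.
have cA : continuous (fun v : R => dyadic_mean m u (dyadic_step m * (2^-1 * v))).
  have := @continuous_affine_comp _ 0 2^-1 (c m (dyadic_step m)).
  by under eq_fun do rewrite add0r.
have cB := @continuous_affine_comp _ 2^-1 2^-1 (c m (dyadic_step m)).
rewrite (Rintegral_halve (c m _)) -RintegralD //; last 2 first.
- exact: continuous_itv_integrable.
- exact: continuous_itv_integrable.
rewrite -RintegralZl //; last first.
  apply: (@continuous_itv_integrable _ (fun v : R => _ + _)) => v.
  by apply: cvgD; [exact: cA|exact: cB].
apply: eq_Rintegral => v _ /=; congr (_ * (dyadic_mean _ _ _ + dyadic_mean _ _ _)).
  by rewrite (dyadic_stepS m); field.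
by rewrite (dyadic_stepS m); field.
Qed.

(** Neighbouring vertices of a fine polygon are close, and polygons that differ
    by a rotation through one side are equal, so all polygon means are close to
    the integral mean. *)
Lemma dyadic_mean_le_integral u e : continuous u ->
  (forall x, u (x + 2 * pi) = u x) -> 0 < e ->
  (exists2 d, 0 < d & forall x y, `|x - y| < d -> `|u x - u y| <= e) ->
  exists m, forall x,
    dyadic_mean m u x <= \int[leb]_(v in `[0, 1]) u (2 * pi * v) + e.
Proof.
move=> cu pu e0 [d d0 dP]; have [m md] := dyadic_step_small d0.
exists m => x; rewrite (Rintegral_dyadic_mean m cu).
have [y /andP[y0 ys] ->] := periodic_reduce (dyadic_step_gt0 m)
  (dyadic_mean_periodic m pu) x.
rewrite -[leLHS]Rintegral_unit_cst -[X in _ + X]Rintegral_unit_cst.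
have c : continuous (fun v => dyadic_mean m u (dyadic_step m * v)).
  have := @continuous_affine_comp _ 0 (dyadic_step m) (@dyadic_mean_continuous m u cu).
  by under eq_fun do rewrite add0r.
have ic (k : R) : leb.-integrable `[0%R, 1%R] (EFin \o (fun=> k)).
  by apply: continuous_itv_integrable => v; exact: cst_continuous.
have ig := continuous_itv_integrable 0 1 c.
rewrite -RintegralD //.
apply: le_Rintegral => //; first exact: (integrableD _ ig (ic e)).
move=> v; rewrite /= in_itv /= => /andP[v0 v1].
have s0 := dyadic_step_gt0 m.
have h1 : 0 <= dyadic_step m * v by rewrite mulr_ge0 // ltW.
have h2 : dyadic_step m * v <= dyadic_step m by rewrite ler_piMr // ltW.
have yv : `|y - dyadic_step m * v| < d.
  by apply: le_lt_trans md; rewrite ler_norml; lra.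
have /ler_normlP[_] := @dyadic_mean_uniform m u d e dP _ _ yv.
lra.
Qed.

Lemma periodic_uniform u : continuous u -> (forall x, u (x + 2 * pi) = u x) ->
  forall e, 0 < e ->
  exists2 d, 0 < d & forall x y, `|x - y| < d -> `|u x - u y| <= e.
Proof.
move=> cu pu e e0.
have pi0 : 0 < 2 * pi :> R by rewrite mulr_gt0 ?pi_gt0.
have ch (z : R[i]) : continuous_at (fun z => (u (complex.Re z))%:C) z.
  move=> k k0; have [d d0 dP] := continuous_real_at (complex.Re z) cu k0.
  exists d => // w wz; rewrite -rcB normc_real; apply: dP.
  by apply: le_lt_trans wz; rewrite -ReN -ReD; exact: Re_le_normc.
have [d d0 dP] := curve_uniform (curve_real 0 (2 * pi)) (fun v _ => ch _) e0.
exists d => // x y xy.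
have [x0 /andP[x00 x0T] xE] := periodic_reduce (F := fun x t => u (x + t)) pi0
  (fun x => funext (fun t => etrans (congr1 u (addrAC x (2 * pi) t)) (pu (x + t)))) x.
have -> : u x = u x0 by have := congr1 (@^~ 0) xE; rewrite /= !addr0.
have -> : u y = u (x0 + (y - x)).
  by have := congr1 (@^~ (y - x)) xE; rewrite /= addrC subrK.
have v01 : 0 <= x0 / (2 * pi) <= 1.
  by rewrite divr_ge0 ?(ltW pi0) //= ler_pdivrMr // mul1r ltW.
have := dP _ v01 (x0 + (y - x))%:C.
rewrite add0r [2 * pi * (_ / _)]mulrC divfK ?gt_eqF // -rcB normc_real.
rewrite addrAC subrr add0r distrC => /(_ xy).
by rewrite -rcB normc_real distrC.
Qed.

End PowerMeans.

(** * From suprema to power means *)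

Section Transference.
Context {R : realType}.
Notation leb := (@lebesgue_measure R).
Implicit Types (f F : R[i] -> R[i]) (x y a r p kappa : R).

Definition power_mean p f r : R :=
  \int[leb]_(v in `[0, 1]) (normc (f (circle_point r (2 * pi * v))) `^ p).

Lemma curve_circle_angle r : curve (fun x => circle_point r x).
Proof.
have pi0 : 2 * pi != 0 :> R by rewrite gt_eqF // mulr_gt0 ?pi_gt0.
have := @curve_affine _ _ 0 (2 * pi)^-1 (@curve_circle R r).
by under eq_fun do rewrite add0r mulrA divff // mul1r.
Qed.

Lemma power_continuous (phi : R -> R[i]) p : 1 <= p -> curve phi ->
  continuous (fun x => normc (phi x) `^ p).
Proof.
move=> p1 cphi x; apply/cvgrPdist_le => e e0.
have [d d0 dP] := powR_continuous_nneg p1 (normc_ge0 (phi x)) e0.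
have /cvgrPdist_lt/(_ d d0) := @curve_normc _ _ cphi x.
by apply: filterS => y xy; rewrite distrC; apply: dP; rewrite ?normc_ge0 // distrC.
Qed.

(** The weights [c a] make [c a * F] equal to the [p]-th power of the modulus of
    [F] at each vertex; Young's inequality separates the resulting products, and
    the part involving [F] is absorbed on the left. *)
Lemma polygon_duality p kappa r (s : seq R) F f x T : 1 <= p -> 0 < kappa ->
  (forall (c : R -> R[i]) B,
    (forall y, normc (\sum_(a <- s) c a * f (circle_point 1 a * circle_point r y)) <= B) ->
    forall x, normc (\sum_(a <- s) c a * F (circle_point 1 a * circle_point r x)) <= kappa * B) ->
  (forall y, \sum_(a <- s) normc (f (circle_point r (y + a))) `^ p <= T) ->
  \sum_(a <- s) normc (F (circle_point r (x + a))) `^ p <= kappa `^ p * T.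
Proof.
move=> p1 k0 H fT; have p0 : 0 < p by lra.
have cpE a y : circle_point 1 a * circle_point r y = circle_point r (y + a).
  by rewrite [circle_point r y]circle_pointE [RHS]circle_pointE circle_pointD; ring.
have /choice[c0 c0P] : forall a, exists c, normc c = 1 /\
    c * F (circle_point r (x + a)) = (normc (F (circle_point r (x + a))))%:C.
  by move=> a; have [c c1 cE] := exists_unimodular (F (circle_point r (x + a))); exists c.
pose n a := normc (F (circle_point r (x + a))).
pose c a := (n a `^ (p - 1))%:C * c0 a.
have nc a : normc (c a) = n a `^ (p - 1).
  by rewrite normcM (c0P a).1 mulr1 normc_real ger0_norm ?powR_ge0.
set X := \sum_(a <- s) _; pose B := ((1 - p^-1) * X + p^-1 * (kappa `^ p * T)) / kappa.
have HB y : normc (\sum_(a <- s) c a * f (circle_point 1 a * circle_point r y)) <= B.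
  apply: le_trans (normc_sum _ _) _; rewrite /B ler_pdivlMr // mulr_suml.
  apply: (@le_trans _ _ (\sum_(a <- s) ((1 - p^-1) * n a `^ p +
      p^-1 * (kappa `^ p * normc (f (circle_point r (y + a))) `^ p)))).
    apply: ler_sum => a _; rewrite normcM nc cpE -mulrA [_ * kappa]mulrC.
    rewrite -powRM ?normc_ge0 ?(ltW k0) //.
    by apply: Young_powR; rewrite ?normc_ge0 // mulr_ge0 ?normc_ge0 // ltW.
  rewrite big_split /= -!mulr_sumr -/X lerD2l.
  rewrite ler_wpM2l ?invr_ge0 ?(ltW p0) // ler_wpM2l ?powR_ge0 //.
have := H c B HB x.
have -> : \sum_(a <- s) c a * F (circle_point 1 a * circle_point r x) = X%:C.
  rewrite /X (big_morph (real_complex R) (@rcD R) (erefl _)).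
  apply: eq_bigr => a _; rewrite cpE /c -mulrA (c0P a).2 -rcM -/(n a) mulrC.
  by rewrite mulr_powRB1 // normc_ge0.
rewrite normc_real ger0_norm; last first.
  by apply: sumr_ge0 => a _; exact: powR_ge0.
rewrite /B mulrC divfK ?gt_eqF // mulrBl mul1r => h.
have {h} : p^-1 * X <= p^-1 * (kappa `^ p * T) by lra.
by rewrite ler_pM2l // invr_gt0.
Qed.

(** Passing from the supremum norm to power means: on the vertices of a
    polygon duality turns the power mean of [F] into a value of a combination of
    rotations of [F], to which the supremum bound applies. *)
Lemma transference p kappa r F f : 1 <= p -> 0 < kappa ->
  (forall z, continuous_at f z) -> (forall z, continuous_at F z) ->
  (forall (s : seq R) (c : R -> R[i]) B,
    (forall y, normc (\sum_(a <- s) c a * f (circle_point 1 a * circle_point r y)) <= B) ->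
    forall x, normc (\sum_(a <- s) c a * F (circle_point 1 a * circle_point r x)) <= kappa * B) ->
  power_mean p F r <= kappa `^ p * power_mean p f r.
Proof.
move=> p1 k0 cf cF H; rewrite -subr_le0; apply: le_all_eps => e e0.
have kp0 : 0 < kappa `^ p by exact: powR_gt0.
pose uf x := normc (f (circle_point r x)) `^ p.
pose uF x := normc (F (circle_point r x)) `^ p.
have cuf : continuous uf.
  by apply: power_continuous => //; apply: (@curve_comp _ f) => //; exact: curve_circle_angle.
have cuF : continuous uF.
  by apply: power_continuous => //; apply: (@curve_comp _ F) => //; exact: curve_circle_angle.
have puf x : uf (x + 2 * pi) = uf x by rewrite /uf circle_point_2pi.
have e1 : 0 < e / kappa `^ p by rewrite divr_gt0.
have [m mP] := dyadic_mean_le_integral cuf puf e1 (periodic_uniform cuf puf e1).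
rewrite -/(power_mean p f r) in mP.
have [s sE] := @dyadic_mean_sum R m.
have p2 : 0 < 2 ^+ m :> R by rewrite exprn_gt0.
have DF x : dyadic_mean m uF x <= kappa `^ p * (power_mean p f r + e / kappa `^ p).
  rewrite sE ler_pdivrMl // mulrCA; apply: polygon_duality => // [c B|y].
    exact: H.
  by rewrite -ler_pdivrMl // -(sE uf); exact: mP.
rewrite lerBlDl.
have -> : kappa `^ p * power_mean p f r + e =
  kappa `^ p * (power_mean p f r + e / kappa `^ p) by field; rewrite gt_eqF.
rewrite /power_mean -/(uF _) (_ : \int[leb]_(v in `[0, 1]) _ =
  \int[leb]_(v in `[0, 1]) dyadic_mean m uF (dyadic_step m * v)); last first.
  exact: (Rintegral_dyadic_mean m cuF).
rewrite -[leRHS]Rintegral_unit_cst; apply: le_Rintegral => //.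
- have := @continuous_affine_comp _ _ 0 (dyadic_step m) (@dyadic_mean_continuous _ m _ cuF).
  by under eq_fun do rewrite add0r; exact: continuous_itv_integrable.
- by apply: (@continuous_itv_integrable _ (fun=> _)) => v; exact: cst_continuous.
Qed.

End Transference.

(** * Comparison of mixed norms *)

Section LowerIntegral.
Local Open Scope ereal_scope.
Context d {T : measurableType d} {R : realType}.
Variables (mu : {measure set T -> \bar R}).

(** The integral of a nonnegative function is a supremum over simple functions
    below it, so comparison needs no measurability. *)
Lemma le_integral_scale (D : set T) (g h : T -> \bar R) (k : R) :
  (0 < k)%R -> (forall x, D x -> 0 <= g x) -> (forall x, D x -> 0 <= h x) ->
  (forall x, D x -> g x <= k%:E * h x) ->
  \int[mu]_(x in D) g x <= k%:E * \int[mu]_(x in D) h x.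
Proof.
move=> k0 g0 h0 gh; rewrite !ge0_integralE //.
apply: ge_ereal_sup => _ [s sg <-].
have ki0 : (0 <= k^-1)%R by rewrite invr_ge0 ltW.
rewrite -lee_pdivrMl // -sintegralrM.
apply: ereal_sup_ubound; exists (scale_nnsfun s ki0) => //= x.
have := sg x; rewrite /patch; case: ifPn => [/set_mem Dx sx|_ sx].
  rewrite EFinM lee_pdivrMl //; exact: le_trans sx (gh x Dx).
rewrite lee_fin in sx; rewrite -[point]/(0%:E) lee_fin.
by rewrite pmulr_rle0 // invr_gt0.
Qed.

End LowerIntegral.

Section Norms.
Context {R : realType}.
Notation leb := (@lebesgue_measure R).
Implicit Types (f F : R[i] -> R[i]) (T : (R[i] -> R[i]) -> R[i] -> R[i]).
Implicit Types (p q : \bar R) (r kappa : R) (phi : R -> R).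

Lemma normc_circle_point_ge0 r x : 0 <= r -> normc (circle_point r x) = r.
Proof. by move=> r0; rewrite normc_circle_point ger0_norm. Qed.

Lemma integral_mean_power (p : R) f r : 1 <= p -> (forall z, continuous_at f z) ->
  integral_mean p%:E f r = ((power_mean p f r) `^ p^-1)%:E.
Proof.
move=> p1 cf; rewrite /integral_mean.
have pi0 : 0 < 2 * pi :> R by rewrite mulr_gt0 ?pi_gt0.
pose u x := normc (f (circle_point r x)) `^ p.
have cu : continuous u.
  by apply: power_continuous => //; apply: (@curve_comp _ f) => //; exact: curve_circle_angle.
have iu := continuous_itv_integrable 0 (2 * pi) cu.
have H : \int[leb]_(x in `[0, 2 * pi]) u x = 2 * pi * power_mean p f r.
  have H0 := Rintegral_affine 0 cu pi0.
  rewrite add0r in H0; rewrite H0; apply: (congr1 ( *%R (2 * pi))).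
  by apply: eq_Rintegral => v _; exact: (congr1 u (add0r _)).
have -> : (\int[leb]_(x in `[0%R, (2 * pi)%R]) (u x)%:E =
    (2 * pi * power_mean p f r)%:E)%E.
  by rewrite -H /Rintegral fineK //; exact: integrable_fin_num.
by rewrite -EFinM mulrA mulVf ?gt_eqF // mul1r poweR_EFin.
Qed.

Lemma integral_mean_ge0 p f r : (1 <= p)%E -> 0 <= r -> (0 <= integral_mean p f r)%E.
Proof.
case: p => [p||] //= _ r0; first exact: poweR_ge0.
apply: (@le_trans _ _ (normc (f (circle_point r 0)))%:E).
  by rewrite lee_fin normc_ge0.
apply: ereal_sup_ubound; exists (circle_point r 0) => //.
exact: normc_circle_point_ge0.
Qed.

Lemma integral_mean_cst p c r : (1 <= p)%E -> 0 <= r ->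
  integral_mean p (fun=> c) r = (normc c)%:E.
Proof.
case: p => [p||] // p1 r0.
  rewrite lee_fin in p1.
  rewrite integral_mean_power //; last by move=> z; apply/cdiff_continuous/cdiff_cst.
  rewrite /power_mean Rintegral_unit_cst -powRrM divff ?powRr1 ?normc_ge0 //.
  by rewrite gt_eqF //; lra.
rewrite /= (_ : [set _ | _ in _] = [set (normc c)%:E]) ?ereal_sup1 //.
apply/seteqP; split => [_ [z _ <-]//|_ ->].
by exists (circle_point r 0) => //; exact: normc_circle_point_ge0.
Qed.

(** Linearity and commutation with dilations let such an operator act termwise on
    the combinations of rotations that occur in [transference]. *)
Definition rot_operator T : Prop :=
  [/\ forall f, (forall z, cdiff_at f z) -> forall z, cdiff_at (T f) z,
      forall a f g, (forall z, cdiff_at f z) -> (forall z, cdiff_at g z) ->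
        T (fun z => a * f z + g z) = (fun z => a * T f z + T g z)
    & forall c f, (forall z, cdiff_at f z) ->
        T (fun z => f (c * z)) = (fun z => T f (c * z))].

(** The conclusion covers every [z] of modulus [r], and not only the points
    [circle_point r x], because the supremum for [p = +oo] runs over all of them. *)
Definition sup_bounded T kappa : Prop :=
  forall f r B, (forall z, cdiff_at f z) -> 0 <= r ->
    (forall x, normc (f (circle_point r x)) <= B) ->
    forall z, normc z = r -> normc (T f z) <= kappa * B.

Lemma rot_operator0 T : rot_operator T -> T (fun=> 0) = (fun=> 0).
Proof.
move=> [_ lin _]; have d0 := @cdiff_cst R 0.
have := lin (-1) (fun=> 0) (fun=> 0) d0 d0.
under eq_fun do rewrite mulr0 addr0.
move=> E; rewrite E; apply/funext => z.
by rewrite E; ring.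
Qed.

Lemma rot_operator_sum T f (s : seq R) (c : R -> R[i]) : rot_operator T ->
  (forall z, cdiff_at f z) ->
  T (fun z => \sum_(a <- s) c a * f (circle_point 1 a * z)) =
  (fun z => \sum_(a <- s) c a * T f (circle_point 1 a * z)).
Proof.
move=> rT df; have [_ lin rot] := rT.
elim: s => [|a s IH].
  under [in LHS]eq_fun do rewrite big_nil.
  by under [in RHS]eq_fun do rewrite big_nil; exact: rot_operator0.
under [in LHS]eq_fun do rewrite big_cons.
under [in RHS]eq_fun do rewrite big_cons.
rewrite (lin (c a) (fun z => f (circle_point 1 a * z))).
- by rewrite rot // IH.
- by move=> z; exact: cdiff_scale.
- move=> z; apply: cdiff_sum => b.
  by apply: cdiffM; [exact: cdiff_cst|exact: cdiff_scale].
Qed.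

Lemma integral_mean_le p T kappa f r : (1 <= p)%E -> 0 < kappa ->
  rot_operator T -> sup_bounded T kappa -> (forall z, cdiff_at f z) -> 0 <= r ->
  (integral_mean p (T f) r <= kappa%:E * integral_mean p f r)%E.
Proof.
move=> p1 k0 rT bT df r0; have [dT _ _] := rT.
have cf z := cdiff_continuous (df z).
have cF z := cdiff_continuous (dT f df z).
case: p p1 => [p||] // p1.
  rewrite lee_fin in p1; have p0 : 0 < p by lra.
  rewrite !integral_mean_power // -EFinM lee_fin.
  have P0 : 0 <= power_mean p f r.
    by apply: Rintegral_ge0 => v _; exact: powR_ge0.
  have kE : kappa = (kappa `^ p) `^ p^-1.
    by rewrite -powRrM divff ?gt_eqF // powRr1 // ltW.
  rewrite {1}kE -powRM ?powR_ge0 //.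
  apply: ge0_ler_powR; first by rewrite invr_ge0 ltW.
  - by rewrite nnegrE; apply: Rintegral_ge0 => v _; exact: powR_ge0.
  - by rewrite nnegrE mulr_ge0 ?powR_ge0.
  apply: transference => // s c B HB x.
  have := bT (fun z => \sum_(a <- s) c a * f (circle_point 1 a * z)) r B _ r0 HB
    (circle_point r x).
  rewrite rot_operator_sum // normc_circle_point ger0_norm //; apply => // z.
  apply: cdiff_sum => b.
  by apply: cdiffM; [exact: cdiff_cst|exact: cdiff_scale].
have [|fin] := eqVneq (integral_mean +oo f r) +oo%E.
  by move=> ->; rewrite gt0_muley ?leey // lte_fin.
have m0 := integral_mean_ge0 f p1 r0.
have mfin : integral_mean +oo f r \is a fin_num.
  by rewrite ge0_fin_numE // lt_neqAle fin leey.
apply: ge_ereal_sup => _ [z zr <-].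
rewrite -(fineK mfin) -EFinM lee_fin.
apply: (bT f r) => // x; rewrite -lee_fin fineK //.
apply: ereal_sup_ubound; exists (circle_point r x) => //.
exact: normc_circle_point_ge0.
Qed.

Lemma weight_density_ge0 (q : R) phi r : 0 <= r -> (0 <= (expR (- (q * phi r)) * r)%:E)%E.
Proof. by move=> r0; rewrite lee_fin mulr_ge0 // expR_ge0. Qed.

Lemma fock_norm_ge0 p q phi f : (1 <= p)%E -> (1 <= q)%E -> (0 <= fock_norm p q phi f)%E.
Proof.
move=> p1; case: q => [q||] // q1; first exact: poweR_ge0.
apply: (@le_trans _ _ (integral_mean p f 0 * (expR (- phi 0))%:E)%E).
  by rewrite mule_ge0 ?integral_mean_ge0 // lee_fin expR_ge0.
by apply: ereal_sup_ubound; exists 0 => //=.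
Qed.

Lemma fock_norm_le_means p q phi F f kappa : (1 <= p)%E -> (1 <= q)%E -> 0 < kappa ->
  (forall r, 0 <= r -> (integral_mean p F r <= kappa%:E * integral_mean p f r)%E) ->
  (fock_norm p q phi F <= kappa%:E * fock_norm p q phi f)%E.
Proof.
move=> p1 q1 k0 Ff; case: q q1 => [q||] // q1.
  rewrite lee_fin in q1; have q0 : 0 < q by lra.
  have kE : kappa%:E = (((kappa `^ q)%:E) `^ q^-1)%E.
    by rewrite poweR_EFin -powRrM divff ?gt_eqF // powRr1 // ltW.
  have f0 r : `[0%R, +oo[%classic r ->
      (0 <= (integral_mean p f r) `^ q * (expR (- (q * phi r)) * r)%:E)%E.
    rewrite /= in_itv /= andbT => r0.
    by rewrite mule_ge0 ?poweR_ge0 ?weight_density_ge0.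
  have F0 r : `[0%R, +oo[%classic r ->
      (0 <= (integral_mean p F r) `^ q * (expR (- (q * phi r)) * r)%:E)%E.
    rewrite /= in_itv /= andbT => r0.
    by rewrite mule_ge0 ?poweR_ge0 ?weight_density_ge0.
  have I0 := @integral_ge0 _ _ R leb _ _ f0.
  have J0 := @integral_ge0 _ _ R leb _ _ F0.
  rewrite /fock_norm {1}kE -poweRM ?lee_fin ?powR_ge0 //.
  apply: gt0_ler_poweR; rewrite ?invr_ge0 ?(ltW q0) //.
  - by rewrite in_itv /= J0 leey.
  - by rewrite in_itv /= leey andbT mule_ge0 // lee_fin powR_ge0.
  apply: le_integral_scale => //; first exact: powR_gt0.
  move=> r; rewrite /= in_itv /= andbT => r0.
  rewrite muleA; apply: lee_wpmul2r; first exact: weight_density_ge0.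
  have kmf : (0 <= kappa%:E * integral_mean p f r)%E.
    by rewrite mule_ge0 ?integral_mean_ge0 // lee_fin ltW.
  rewrite -poweR_EFin -poweRM ?integral_mean_ge0 ?lee_fin ?(ltW k0) //.
  apply: gt0_ler_poweR; [exact: ltW| | |exact: Ff].
  - by rewrite in_itv /= leey integral_mean_ge0.
  - by rewrite in_itv /= leey andbT.
apply: ge_ereal_sup => _ [r /= r0 <-].
apply: (@le_trans _ _ (kappa%:E * (integral_mean p f r * (expR (- phi r))%:E))%E).
  by rewrite muleA; apply: lee_wpmul2r; [rewrite lee_fin expR_ge0|exact: Ff].
apply: lee_wpmul2l; first by rewrite lee_fin ltW.
by apply: ereal_sup_ubound; exists r.
Qed.

Lemma fock_norm_operator_le p q phi T kappa f : (1 <= p)%E -> (1 <= q)%E -> 0 < kappa ->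
  rot_operator T -> sup_bounded T kappa -> (forall z, cdiff_at f z) ->
  (fock_norm p q phi (T f) <= kappa%:E * fock_norm p q phi f)%E.
Proof.
move=> p1 q1 k0 rT bT df; apply: fock_norm_le_means => // r r0.
exact: integral_mean_le.
Qed.

End Norms.

(** * Cesaro means of operators commuting with rotations *)

Section OperatorAlgebra.
Context {R : realType}.
Implicit Types (f g : R[i] -> R[i]) (T U Q : (R[i] -> R[i]) -> R[i] -> R[i]).
Implicit Types (r kappa rho K B : R) (c : R[i]).

Lemma rot_operator_id : rot_operator (fun f : R[i] -> R[i] => f).
Proof. by split. Qed.

Lemma rot_operator_zero : rot_operator (fun (_ : R[i] -> R[i]) _ => 0).
Proof.
split => [f _ z|a f g _ _|c f _] //; first exact: cdiff_cst.
by apply/funext => z; rewrite mulr0 addr0.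
Qed.

Lemma rot_operator_eval0 : rot_operator (fun (f : R[i] -> R[i]) _ => f 0).
Proof.
split => [f _ z|a f g _ _|c f _] //; first exact: cdiff_cst.
by apply/funext => z; rewrite mulr0.
Qed.

Lemma rot_operator_comp T U : rot_operator T -> rot_operator U ->
  rot_operator (fun f => T (U f)).
Proof.
move=> [dT lT oT] [dU lU oU]; split => [f df z|a f g df dg|c f df].
- by apply: dT; exact: dU.
- by rewrite lU // lT //; exact: dU.
- by rewrite oU // oT //; exact: dU.
Qed.

Lemma rot_operatorMD c T U : rot_operator T -> rot_operator U ->
  rot_operator (fun f z => c * T f z + U f z).
Proof.
move=> [dT lT oT] [dU lU oU]; split => [f df z|a f g df dg|b f df].
- apply: cdiffD; last exact: dU.
  by apply: cdiffM; [exact: cdiff_cst|exact: dT].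
- by rewrite lT // lU //; apply/funext => z; ring.
- by rewrite oT // oU.
Qed.

Lemma rot_operator_iter k T : rot_operator T -> rot_operator (iter k T).
Proof.
move=> rT; elim: k => [|k IH]; first exact: rot_operator_id.
exact: (rot_operator_comp rT IH).
Qed.

Lemma rot_operator_sum_iter (s : seq nat) T : rot_operator T ->
  rot_operator (fun f z => \sum_(k <- s) iter k T f z).
Proof.
move=> rT; elim: s => [|k s IH].
  have -> : (fun f z => \sum_(k <- [::]) iter k T f z) = (fun _ _ => 0).
    by apply/funext => f; apply/funext => z; rewrite big_nil.
  exact: rot_operator_zero.
have -> : (fun f z => \sum_(j <- k :: s) iter j T f z) =
    (fun f z => 1 * iter k T f z + \sum_(j <- s) iter j T f z).
  by apply/funext => f; apply/funext => z; rewrite big_cons mul1r.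
by apply: rot_operatorMD => //; exact: rot_operator_iter.
Qed.

Lemma sup_bounded_eval0 : sup_bounded (fun (f : R[i] -> R[i]) _ => f 0) 1.
Proof.
move=> f r B df r0 fB z _; rewrite mul1r.
have [r_eq0|rn0] := eqVneq r 0.
  by have := fB 0; rewrite r_eq0 circle_point0.
by apply: (entire_max_modulus df) fB; rewrite normc0 lt_def rn0.
Qed.

Lemma sup_bounded_le T kappa kappa' : kappa <= kappa' ->
  sup_bounded T kappa -> sup_bounded T kappa'.
Proof.
move=> kk bT f r B df r0 fB z zr; apply: le_trans (bT f r B df r0 fB z zr) _.
by rewrite ler_wpM2r // (le_trans (normc_ge0 _) (fB 0)).
Qed.

Definition cesaro_gap T Q (n : nat) f : R[i] -> R[i] :=
  fun z => n%:R^-1 * (\sum_(1 <= k < n.+1) iter k T f z) - Q f z.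

Lemma cesaro_meanE T Q n f :
  cesaro_mean (T : (R[i] -> R[i]^o) -> R[i] -> R[i]^o) n f - Q f = cesaro_gap T Q n f.
Proof.
apply/funext => z; rewrite /cesaro_gap /cesaro_mean; congr (_ - _).
by congr (_ * _); rewrite fct_sumE.
Qed.

Lemma rot_operator_cesaro_gap T Q n : rot_operator T -> rot_operator Q ->
  rot_operator (cesaro_gap T Q n).
Proof.
move=> rT rQ.
have -> : cesaro_gap T Q n = (fun f z => n%:R^-1 *
    (\sum_(k <- index_iota 1 n.+1) iter k T f z) + ((-1) * Q f z + 0)).
  by apply/funext => f; apply/funext => z; rewrite /cesaro_gap addr0 mulN1r.
apply: rot_operatorMD; first exact: rot_operator_sum_iter.
by apply: rot_operatorMD => //; exact: rot_operator_zero.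
Qed.

Lemma geometric_sum_le rho n : 0 <= rho < 1 ->
  \sum_(1 <= k < n.+1) rho ^+ k <= (1 - rho)^-1.
Proof.
move=> /andP[rho0 rho1]; have r1 : 0 < 1 - rho by rewrite subr_gt0.
rewrite -[leRHS]mul1r ler_pdivlMr //.
have -> : (\sum_(1 <= k < n.+1) rho ^+ k) * (1 - rho) = rho - rho ^+ n.+1.
  elim: n => [|n IH]; first by rewrite big_geq // mul0r expr1 subrr.
  by rewrite big_nat_recr //= mulrDl IH [rho ^+ n.+2]exprS; ring.
by have := exprn_ge0 n.+1 rho0; lra.
Qed.

Lemma cesaro_gap_sup_bounded T Q K rho n : 0 <= rho < 1 -> 0 <= K -> (0 < n)%N ->
  (forall f r B, (forall z, cdiff_at f z) -> 0 <= r ->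
    (forall x, normc (f (circle_point r x)) <= B) ->
    forall k z, normc z = r ->
      normc (iter k.+1 T f z - Q f z) <= K * rho ^+ k.+1 * B) ->
  sup_bounded (cesaro_gap T Q n) (K / (1 - rho) / n%:R).
Proof.
move=> rho01 K0 n0 H f r B df r0 fB z zr.
have n0R : 0 < n%:R :> R by rewrite ltr0n.
have nC : n%:R != 0 :> R[i] by rewrite pnatr_eq0 -lt0n.
have B0 : 0 <= B by apply: le_trans (normc_ge0 _) (fB 0).
have -> : cesaro_gap T Q n f z =
    n%:R^-1 * \sum_(1 <= k < n.+1) (iter k T f z - Q f z).
  rewrite sumrB sumr_const_nat subSS subn0 /cesaro_gap mulrBr -[Q f z *+ n]mulr_natl.
  by rewrite mulKf.
rewrite normcM normcV normc_nat mulrC mulrAC ler_wpM2r ?invr_ge0 ?ler0n //.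
apply: le_trans (normc_sum _ _) _.
apply: (@le_trans _ _ (\sum_(1 <= k < n.+1) K * rho ^+ k * B)).
  rewrite big_nat_cond [leRHS]big_nat_cond.
  apply: ler_sum => -[|k] /andP[/andP[k1 _] _]; first by rewrite ltnn in k1.
  exact: (H f r B df r0 fB k z zr).
rewrite -mulr_suml -mulr_sumr; apply: ler_wpM2r => //; apply: ler_wpM2l => //.
exact: geometric_sum_le.
Qed.

End OperatorAlgebra.

(** * The norm of the constant function 1 *)

Section UnitNorm.
Context {R : realType}.
Notation leb := (@lebesgue_measure R).
Implicit Types (p q : \bar R) (phi : R -> R).

Lemma fock_norm_unit_lty p q phi : (1 <= p)%E -> (1 <= q)%E -> weight q phi ->
  (fock_norm p q phi (fun=> 1%R) < +oo)%E.
Proof.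
move=> p1; case: q => [q||] // q1 [phi0 _ wq].
  rewrite /fock_norm; apply: poweR_lty; move: wq; rewrite /weight_integrable => wq.
  apply: le_lt_trans wq; rewrite le_eqVlt; apply/orP; left; apply/eqP.
  apply: eq_integral => r.
  rewrite inE /= in_itv /= andbT => r0.
  by rewrite integral_mean_cst // normc1 poweR1r mul1e.
apply: (@le_lt_trans _ _ 1%E); last by rewrite ltry.
apply: ge_ereal_sup => _ [r /= r0 <-].
rewrite integral_mean_cst // normc1 mul1e lee_fin -expR0 ler_expR oppr_le0 ltW //.
exact: phi0.
Qed.

(** Boundedness on an interval of positive length is what makes the norm of a
    nonzero constant positive. *)
Lemma weight_locally_bounded q phi : weight q phi ->
  exists K d, 0 < d /\ forall s, 1 < s < 1 + d -> phi s <= K.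
Proof.
move=> [_ [/(_ 1 ler01) /cvg_ex[l /cvgrPdist_le/(_ 1 ltr01) H] _] _].
have {H} [d d0 dP] : exists2 d, 0 < d & forall s, 1 < s < 1 + d ->
    `|l - half_line_quotient phi 1 s| <= 1.
  move: H; rewrite near_withinE => /nbhs_ballP[d /= d0 dP].
  exists d => // s /andP[s1 sd]; apply: dP => /=; last lra.
    by rewrite /ball /= ltr0_norm ?subr_lt0 // opprB; lra.
  by rewrite gt_eqF.
exists (phi 1 + (`|l| + 1) * d), d; split => // s s1d.
have := dP s s1d; have /andP[s1 sd] := s1d.
rewrite /half_line_quotient; set k := (_ / _) => kl.
have s10 : 0 < s - 1 by rewrite subr_gt0.
have -> : phi s = phi 1 + k * (s - 1) by rewrite /k divfK ?gt_eqF //; ring.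
rewrite lerD2l; apply: le_trans (_ : (`|l| + 1) * (s - 1) <= _).
  rewrite ler_pM2r //; move: kl; rewrite ler_norml.
  have := ler_norm l; lra.
by rewrite ler_wpM2l ?addr_ge0 //; lra.
Qed.

Lemma fock_norm_unit_gt0 p q phi : (1 <= p)%E -> (1 <= q)%E -> weight q phi ->
  (0 < fock_norm p q phi (fun=> 1%R))%E.
Proof.
move=> p1 q1 wphi; case: q q1 wphi => [q||] // q1 wphi; last first.
  apply: (@lt_le_trans _ _ (expR (- phi 0))%:E); first by rewrite lte_fin expR_gt0.
  apply: ereal_sup_ubound; exists 0 => //=.
  by rewrite integral_mean_cst // normc1 mul1e.
have [K [d [d0 dP]]] := weight_locally_bounded wphi.
apply: poweR_gt0.
pose w (r : R) := (integral_mean p (fun=> 1%R) r `^ q * (expR (- (q * phi r)) * r)%:E)%E.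
change (0 < \int[leb]_(r in `[0%R, +oo[) w r)%E.
rewrite lee_fin in q1.
(* On [A] both [phi r <= K] and [1 <= r] hold, so the density dominates a multiple
   of the indicator of [A]. *)
pose A : set (measurableTypeR R) := `[1 + d / 4, 1 + d / 2]%classic.
have measA : measurable A by exact: measurable_itv.
have c0 := expR_gt0 (- (q * K)).
have wE r : 0 <= r -> w r = (expR (- (q * phi r)) * r)%:E.
  by move=> r0; rewrite /w integral_mean_cst // normc1 poweR1r mul1e.
have H := @le_integral_scale _ _ R leb `[0%R, +oo[%classic
  (fun r => (\1_A r)%:E) w (expR (- (q * K)))^-1 _ _ _ _.
have {H} H : (\int[leb]_(r in `[0%R, +oo[) (\1_A r)%:E <=
    ((expR (- (q * K)))^-1)%:E * \int[leb]_(r in `[0%R, +oo[) w r)%E.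
  apply: H; first by rewrite invr_gt0.
  - by move=> r _; rewrite lee_fin.
  - move=> r; rewrite /= in_itv /= andbT => r0.
    by rewrite wE // lee_fin mulr_ge0 // expR_ge0.
  move=> r; rewrite /= in_itv /= andbT => r0; rewrite wE // -EFinM lee_fin.
  rewrite indicE; case: (boolP (r \in A)) => [|_]; last first.
    by rewrite mulr_ge0 ?invr_ge0 ?mulr_ge0 ?expR_ge0.
  rewrite inE /A /= in_itv /= => /andP[r1 r2].
  rewrite ler_pdivlMl // mulr1.
  have r11 : 1 <= r by lra.
  apply: (@le_trans _ _ (expR (- (q * phi r)))).
    rewrite ler_expR lerN2 ler_wpM2l //; first lra.
    by apply: dP; lra.
  by rewrite ler_peMr // expR_ge0.
have mA : leb (A `&` `[0%R, +oo[) = (d / 4)%:E.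
  rewrite (_ : A `&` _ = A).
    rewrite /A lebesgue_measure_itv /= lte_fin.
    have -> : 1 + d / 4 < 1 + d / 2 by lra.
    by rewrite -EFinD; congr EFin; lra.
  apply/seteqP; split => [r [] //|r Ar]; split => //.
  by move: Ar; rewrite /A /= !in_itv /= andbT; lra.
rewrite (integral_indic _ _ measA) // in H.
have {}H := le_trans (eq_ind_r (fun x => x <= _)%E (lexx _) (esym mA)) H.
rewrite lt_neqAle eq_sym; apply/andP; split; last first.
  apply: integral_ge0 => r; rewrite /= in_itv /= andbT => r0.
  by rewrite wE // lee_fin mulr_ge0 // expR_ge0.
apply/eqP => I0; move: H; rewrite I0 mule0 lee_fin.
lra.
Qed.

End UnitNorm.

(** * Iterates of the Hausdorff operator *)

Section Iterates.
Context {R : realType}.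
Variable mu : {measure set (measurableTypeR R) -> \bar R}.
Hypothesis hmu : mu `]0%R, 1%R]%classic = 0%E.
Hypothesis mass_finite : mu.-integrable `]1%R, +oo[%classic (fun t => (t^-1)%:E).
Implicit Types (f g : R[i] -> R[i]) (z w c : R[i]) (B r : R).

Notation H := (hausdorff mu : (R[i] -> R[i]) -> R[i] -> R[i]).
Notation m0 := (moment mu 0).
Notation m1 := (moment mu 1).

Lemma rot_operator_hausdorff : rot_operator H.
Proof.
split => [f|a f g|c f _]; [exact: hausdorff_entire|exact: hausdorffMD|].
exact: hausdorff_rot.
Qed.

Lemma sup_bounded_hausdorff : sup_bounded H m0.
Proof. by move=> f r B df r0 fB z zr; exact: (hausdorff_sup_le hmu mass_finite df r0 fB zr). Qed.

Lemma iter_hausdorff_entire k f : (forall z, cdiff_at f z) -> forall z, cdiff_at (iter k H f) z.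
Proof. by have [d _ _] := rot_operator_iter k rot_operator_hausdorff; exact: d. Qed.

(** A constant function equals its own composition with [z |-> 0 * z], so only the
    value at the origin has to be computed. *)
Lemma hausdorff_cst c : H (fun=> c) = (fun=> m0%:C * c).
Proof.
have dc := @cdiff_cst R c.
have E := hausdorff_rot mu 0 (fun=> c).
rewrite E; apply/funext => z; rewrite mul0r.
exact: (hausdorff_at0 hmu mass_finite dc).
Qed.

Lemma iter_hausdorff_cst k c : iter k H (fun=> c) = (fun=> (m0 ^+ k)%:C * c).
Proof.
elim: k => [|k IH]; first by rewrite expr0 mul1r.
by rewrite iterS IH hausdorff_cst exprS rcM mulrA.
Qed.

Lemma iter_hausdorff_sup_le k f r B : (forall z, cdiff_at f z) -> 0 <= r ->
  (forall x, normc (f (circle_point r x)) <= B) ->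
  forall x, normc (iter k H f (circle_point r x)) <= m0 ^+ k * B.
Proof.
move=> df r0 fB; elim: k => [|k IH] x; first by rewrite expr0 mul1r.
rewrite exprS -mulrA.
apply: (hausdorff_sup_le hmu mass_finite (iter_hausdorff_entire k df) r0 IH).
exact: normc_circle_point_ge0.
Qed.

Lemma iter_hausdorff_at0 k f : (forall z, cdiff_at f z) -> f 0 = 0 -> iter k H f 0 = 0.
Proof.
move=> df f0; elim: k => [//|k IH].
rewrite iterS (hausdorff_at0 hmu mass_finite (iter_hausdorff_entire k df)).
by rewrite [iter k H f 0]IH mulr0.
Qed.

Lemma iter_hausdorff_sup_le0 k f r B : (forall z, cdiff_at f z) -> f 0 = 0 -> 0 <= r ->
  (forall x, normc (f (circle_point r x)) <= B) ->
  forall x, normc (iter k H f (circle_point r x)) <= m1 ^+ k * B.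
Proof.
move=> df f0 r0 fB; elim: k => [|k IH] x; first by rewrite expr0 mul1r.
rewrite exprS -mulrA.
apply: (hausdorff_sup_le0 hmu mass_finite (iter_hausdorff_entire k df) _ r0 IH).
  exact: iter_hausdorff_at0.
exact: normc_circle_point_ge0.
Qed.

Lemma cesaro_gap_lt1 n : m0 < 1 -> (0 < n)%N ->
  sup_bounded (cesaro_gap H (fun _ _ => 0) n) (1 / (1 - m0) / n%:R).
Proof.
move=> m01 n0; apply: cesaro_gap_sup_bounded => //.
  by rewrite moment_ge0.
move=> f r B df r0 fB k z zr; rewrite subr0 mul1r iterS exprS -mulrA.
apply: (hausdorff_sup_le hmu mass_finite (iter_hausdorff_entire k df) r0 _ zr).
exact: iter_hausdorff_sup_le.
Qed.

(** Subtracting the value at the origin leaves a function that vanishes there,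
    on which the operator contracts with factor [m1]. *)
Lemma cesaro_gap_eq1 n : m0 = 1 -> (0 < n)%N ->
  sup_bounded (cesaro_gap H (fun f _ => f 0) n) (2 / (1 - m1) / n%:R).
Proof.
move=> m01 n0; apply: cesaro_gap_sup_bounded => //.
  by rewrite moment_ge0 moment1_lt.
move=> f r B df r0 fB k z zr.
pose g z := 1 * f z + (- f 0).
have dg v : cdiff_at g v.
  apply: cdiffD; last exact: cdiff_cst.
  by apply: cdiffM; [exact: cdiff_cst|exact: df].
have -> : iter k.+1 H f z - f 0 = iter k.+1 H g z.
  have [_ lin _] := rot_operator_iter k.+1 rot_operator_hausdorff.
  rewrite /g (lin 1 f (fun=> - f 0)) //; last by move=> v; exact: cdiff_cst.
  by rewrite iter_hausdorff_cst m01 expr1n !mul1r.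
have g0 : g 0 = 0 by rewrite /g mul1r subrr.
have gB x : normc (g (circle_point r x)) <= 2 * B.
  rewrite /g mul1r; apply: le_trans (normcB_le _ _) _.
  have := @sup_bounded_eval0 R f r B df r0 fB (circle_point r x)
    (normc_circle_point_ge0 x r0).
  by have := fB x; lra.
rewrite [2 * _]mulrC -mulrA exprS -mulrA iterS.
apply: (hausdorff_sup_le0 hmu mass_finite (iter_hausdorff_entire k dg) _ r0 _ zr).
  exact: iter_hausdorff_at0.
exact: iter_hausdorff_sup_le0.
Qed.

End Iterates.

(** * Operators on the Fock space *)

Section FockSpace.
Context {R : realType}.
Variables (p q : \bar R) (phi : R -> R).
Hypotheses (p1 : (1 <= p)%E) (q1 : (1 <= q)%E) (wphi : weight q phi).
Implicit Types (f g : R[i] -> R[i]^o).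

Lemma fock_cst (c : R[i]) : fock p q phi (fun=> c).
Proof.
split; first by apply/entireP => z; exact: cdiff_cst.
have [->|c0] := eqVneq c 0.
  apply: (@le_lt_trans _ _ (1%:E * fock_norm p q phi (fun=> 1%R))%E).
    apply: fock_norm_le_means => // r r0.
    by rewrite !integral_mean_cst // normc0 normc1 mul1e lee_fin.
  by rewrite mul1e fock_norm_unit_lty.
apply: (@le_lt_trans _ _ ((normc c)%:E * fock_norm p q phi (fun=> 1%R))%E).
  apply: fock_norm_le_means => //; first by rewrite normc_gt0.
  by move=> r r0; rewrite !integral_mean_cst // normc1 mule1.
by rewrite lte_mul_pinfty ?lee_fin ?normc_ge0 // fock_norm_unit_lty.
Qed.

Lemma bounded_linear_rot_operator T kappa : 0 < kappa ->
  rot_operator T -> sup_bounded T kappa ->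
  bounded_linear (fock p q phi) (fock_norm p q phi) (T : (R[i] -> R[i]^o) -> _ -> R[i]^o).
Proof.
move=> k0 rT bT; have [dT lT _] := rT; split.
- move=> f [/entireP df fn]; split; first by apply/entireP; exact: dT.
  apply: le_lt_trans (fock_norm_operator_le phi p1 q1 k0 rT bT df) _.
  by rewrite lte_mul_pinfty ?lee_fin // ltW.
- by move=> a f g [/entireP df _] [/entireP dg _]; exact: lT.
- by exists kappa => f [/entireP df _]; exact: fock_norm_operator_le.
Qed.

Lemma opnorm_rot_operator_le T kappa : 0 < kappa ->
  rot_operator T -> sup_bounded T kappa ->
  (0 <= opnorm (fock p q phi) (fock_norm p q phi)
     (T : (R[i] -> R[i]^o) -> _ -> R[i]^o) <= kappa%:E)%E.
Proof.
move=> k0 rT bT; apply/andP; split; last first.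
  apply: ge_ereal_sup => _ [f [[/entireP df _] fn] <-].
  apply: le_trans (fock_norm_operator_le phi p1 q1 k0 rT bT df) _.
  rewrite -[leRHS]mule1; apply: lee_wpmul2l => //.
  by rewrite lee_fin ltW.
apply: (@le_trans _ _ (fock_norm p q phi (T (fun=> 0)))).
  exact: fock_norm_ge0.
apply: ereal_sup_ubound; exists (fun=> 0) => //; split; first exact: fock_cst.
(* The zero function lies in the unit ball: its norm is at most any positive
   multiple of the norm of the constant 1. *)
have [_] := fock_cst 0.
have H k : 0 < k -> (fock_norm p q phi (fun=> 0%R) <= k%:E * fock_norm p q phi (fun=> 1%R))%E.
  move=> kp; apply: fock_norm_le_means => // r r0.
  by rewrite !integral_mean_cst // normc0 normc1 mule1 lee_fin ltW.
have N0 := fock_norm_unit_gt0 p1 q1 wphi.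
have Nf : fock_norm p q phi (fun=> 1%R) \is a fin_num.
  by rewrite ge0_fin_numE ?ltW // fock_norm_unit_lty.
move=> _; have := H (fine (fock_norm p q phi (fun=> 1%R)))^-1.
rewrite invr_gt0 fine_gt0 ?N0 ?fock_norm_unit_lty // => /(_ isT) h.
apply: le_trans h _; rewrite -[X in (_ * X)%E]fineK // -EFinM mulVf //.
by rewrite gt_eqF // fine_gt0 // N0 fock_norm_unit_lty.
Qed.

Lemma cesaro_gap_uniformly_mean_ergodic T Q kappa K :
  0 < kappa -> rot_operator T -> sup_bounded T kappa ->
  rot_operator Q -> sup_bounded Q 1 -> 0 < K ->
  (forall n, (0 < n)%N -> sup_bounded (cesaro_gap T Q n) (K / n%:R)) ->
  uniformly_mean_ergodic (fock p q phi) (fock_norm p q phi)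
    (T : (R[i] -> R[i]^o) -> _ -> R[i]^o).
Proof.
move=> k0 rT bT rQ bQ K0 gap; split; first exact: bounded_linear_rot_operator bT.
exists Q; split; first exact: (bounded_linear_rot_operator ltr01 rQ bQ).
have gapE n : (fun f : R[i] -> R[i]^o => cesaro_mean T n f - Q f) = cesaro_gap T Q n.
  by apply/funext => f; exact: cesaro_meanE.
pose u (n : nat) : \bar R := opnorm (fock p q phi) (fock_norm p q phi)
  (fun f : R[i] -> R[i]^o => cesaro_mean T n.+1 f - Q f).
rewrite -cvg_shiftS; change (u @ \oo --> 0%E).
have uP : \forall n \near \oo, (0%E <= u n <= (K * harmonic n)%:E)%E.
  near=> n; rewrite /u gapE; apply: opnorm_rot_operator_le.
  - by rewrite divr_gt0.
  - exact: rot_operator_cesaro_gap.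
  - exact: gap.
apply: (squeeze_cvge uP); first exact: cvg_cst.
apply: cvg_EFin; first by near=> n.
have -> : (fine \o (fun n => (K * harmonic n)%:E)) = (fun n => K * harmonic n) by [].
by rewrite -[X in _ --> X](mulr0 K); apply: cvgM; [exact: cvg_cst|exact: cvg_harmonic].
Unshelve. all: by end_near. Qed.

End FockSpace.

(** * The criterion for mean ergodicity *)

Section MeanErgodicity.
Context {R : realType}.
Variables (mu : {measure set (measurableTypeR R) -> \bar R}).
Variables (phi : R -> R) (p q : \bar R).
Hypothesis hmu : mu `]0%R, 1%R]%classic = 0%E.
Hypotheses (wphi : weight q phi) (p1 : (1 <= p)%E) (q1 : (1 <= q)%E).

Notation E := (`]1%R, +oo[%classic : set (measurableTypeR R)).

Lemma tail_inv_ge0 t : E t -> (0 <= (t^-1)%:E)%E.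
Proof. by rewrite /= in_itv /= andbT => t1; rewrite lee_fin invr_ge0; lra. Qed.

Lemma mass_integrable : (\int[mu]_(t in E) (t^-1)%:E < +oo)%E ->
  mu.-integrable E (fun t => (t^-1)%:E).
Proof.
move=> fin; apply/integrableP; split.
  by apply/measurable_EFinP; apply: measurable_funS (@measurable_inv R) => //; exact: subset_tail.
apply: le_lt_trans fin; rewrite le_eqVlt; apply/orP; left; apply/eqP.
by apply: eq_integral => t /set_mem Et; rewrite gee0_abs // tail_inv_ge0.
Qed.

Lemma mass_momentE : mu.-integrable E (fun t => (t^-1)%:E) ->
  (\int[mu]_(t in E) (t^-1)%:E = (moment mu 0)%:E)%E.
Proof.
move=> fin; rewrite /moment /Rintegral.
under [in RHS]eq_integral do rewrite expr1.
by rewrite fineK //; exact: integrable_fin_num.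
Qed.

Lemma hausdorff_ergodic_of_mass_le1 : (\int[mu]_(t in E) (t^-1)%:E <= 1)%E ->
  hausdorff_uniformly_mean_ergodic p q phi mu.
Proof.
move=> mass1; have fin := mass_integrable (le_lt_trans mass1 (ltry 1)).
have m_le1 : moment mu 0 <= 1 by rewrite -lee_fin -mass_momentE.
split.
  by move=> f [/entireP df _] z; have [] := hausdorff_cintegrable hmu fin z df.
have bH : sup_bounded (hausdorff mu : (R[i] -> R[i]) -> R[i] -> R[i]) 1.
  exact: sup_bounded_le m_le1 (sup_bounded_hausdorff hmu fin).
have rH := rot_operator_hausdorff hmu fin.
move: m_le1; rewrite le_eqVlt => /orP[/eqP m1|m_lt1].
  have gap : 0 < 2 / (1 - moment mu 1).
    by rewrite divr_gt0 // subr_gt0 moment1_lt.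
  apply: (cesaro_gap_uniformly_mean_ergodic p1 q1 wphi ltr01 rH bH
    (@rot_operator_eval0 R) (@sup_bounded_eval0 R) gap) => n n0.
  exact: cesaro_gap_eq1.
have gap : 0 < 1 / (1 - moment mu 0) by rewrite divr_gt0 // subr_gt0.
have b0 : sup_bounded (fun (_ : R[i] -> R[i]) _ => 0) 1.
  by move=> f r B _ _ fB z _; rewrite normc0 mul1r (le_trans (normc_ge0 _) (fB 0)).
apply: (cesaro_gap_uniformly_mean_ergodic p1 q1 wphi ltr01 rH bH
  (@rot_operator_zero R) b0 gap) => n n0.
exact: cesaro_gap_lt1.
Qed.

(** Bernoulli's inequality bounds the [k]-th term below by [1 + k * (m - 1)]. *)
Lemma power_sum_ge (m : R) n : 1 <= m ->
  (m - 1) / 2 * n%:R ^+ 2 <= \sum_(1 <= k < n.+1) m ^+ k.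
Proof.
move=> m1; have bern k : 1 + k%:R * (m - 1) <= m ^+ k.
  elim: k => [|k IH]; first by rewrite mul0r addr0 expr0.
  have h := ler_wpM2l (le_trans ler01 m1) IH.
  rewrite exprS; apply: le_trans h; rewrite -natr1.
  have : 0 <= k%:R * ((m - 1) * (m - 1)).
    by rewrite mulr_ge0 ?ler0n // mulr_ge0 // subr_ge0.
  lra.
elim: n => [|n IH]; first by rewrite big_geq // expr0n mulr0.
rewrite big_nat_recr //=; apply: le_trans (lerD IH (bern n.+1)).
rewrite -(natr1 n) sqrrD expr1n mulr1.
move: (ler0n R n); nra.
Qed.

(** On constants the operator is multiplication by the total mass [m]. Values at
    the origin are controlled by the norm, and for [m > 1] the means of the powers
    of [m] are unbounded. *)
Lemma mass_le1_of_hausdorff_ergodic : hausdorff_uniformly_mean_ergodic p q phi mu ->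
  (\int[mu]_(t in E) (t^-1)%:E <= 1)%E.
Proof.
move=> [hdef [_ [P [[PX _ _] gap0]]]].
have fin : mu.-integrable E (fun t => (t^-1)%:E).
  have [i _] := hdef _ (fock_cst p1 q1 wphi 1) 0.
  apply: eq_integrable (integrableS _ _ subset_tail i) => // t _.
  by rewrite /hausdorff_integrand mulr1 -rcV.
rewrite mass_momentE // lee_fin leNgt; apply/negP => m_gt1.
set m := moment mu 0 in m_gt1.
pose N (f : R[i] -> R[i]^o) := fock_norm p q phi f.
have N0 := fock_norm_unit_gt0 p1 q1 wphi.
have Noo := fock_norm_unit_lty p1 q1 wphi.
set N1 := fock_norm p q phi (fun=> 1) in N0 Noo.
have Nfin : N1 \is a fin_num by rewrite ge0_fin_numE // ltW.
pose nu := fine N1; have nu0 : 0 < nu by rewrite fine_gt0 // N0.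
have N1E : N1 = nu%:E by rewrite fineK.
(* The constant [c] lies in the unit ball, so the gap applied to [c] is eventually of
   norm at most 1, and hence so is its value at the origin. *)
have [c c0 c_nu] : exists2 c : R, 0 < c & c * nu = 1.
  by exists nu^-1; [rewrite invr_gt0|rewrite mulVf // gt_eqF].
have Xc := fock_cst p1 q1 wphi c%:C.
have Nc : (N (fun=> c%:C) <= 1)%E.
  apply: (@le_trans _ _ (c%:E * N1)%E).
    apply: fock_norm_le_means => // r r0.
    by rewrite !integral_mean_cst // normc1 mule1 normc_real gtr0_norm.
  by rewrite N1E -EFinM c_nu.
pose y := P (fun=> c%:C) 0.
have [/entireP dP _] := PX _ Xc.
pose avg n : R := n%:R^-1 * \sum_(1 <= k < n.+1) m ^+ k * c.
have gapE n : cesaro_mean (hausdorff mu) n (fun=> c%:C) - P (fun=> c%:C) =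
    (fun z => (avg n)%:C - P (fun=> c%:C) z) :> (R[i] -> R[i]^o).
  rewrite cesaro_meanE; apply/funext => z; congr (_ - _).
  rewrite /avg rcM rcV; congr (_^-1 * _).
    by apply/esym; exact: (rmorph_nat (real_complex R)).
  rewrite (big_morph (real_complex R) (@rcD R) (erefl _)).
  by apply: eq_bigr => k _; rewrite iter_hausdorff_cst // -rcM.
have small : \forall n \near \oo,
    (opnorm (fock p q phi) (fock_norm p q phi)
      (fun x => (cesaro_mean (hausdorff mu) n x - P x)%R) <= 1)%E.
  have /fine_cvgP[F1 /cvgr_le F2] := gap0.
  have {}F2 := F2 1 ltr01.
  by near=> n; rewrite -[leLHS]fineK ?lee_fin; near: n.
have bounded : \forall n \near \oo, normc ((avg n)%:C - y) * nu <= 1.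
  near=> n.
  have Sn : (N (fun z => ((avg n)%:C - P (fun=> c%:C) z)%R) <= 1)%E.
    rewrite -gapE.
    apply: le_trans (near small n _); last by [].
    by apply: ereal_sup_ubound; exists (fun=> c%:C).
  have dS z : cdiff_at (fun z => (avg n)%:C - P (fun=> c%:C) z) z.
    by apply: cdiffB; [exact: cdiff_cst|exact: dP].
  have := fock_norm_operator_le phi p1 q1 ltr01 (@rot_operator_eval0 R)
    (@sup_bounded_eval0 R) dS.
  rewrite mul1e => /le_trans /(_ Sn) /=.
  have [->|a0] := eqVneq ((avg n)%:C - y) 0; first by rewrite normc0 mul0r.
  have na0 : 0 < normc ((avg n)%:C - y) by rewrite normc_gt0.
  move=> Sa; rewrite -ler_pdivlMl // mulr1 -lee_fin -N1E.
  have ki : 0 < (normc ((avg n)%:C - y))^-1 by rewrite invr_gt0.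
  apply: (@le_trans _ _ ((normc ((avg n)%:C - y))^-1%:E *
    fock_norm p q phi (fun=> ((avg n)%:C - y)%R))%E).
    apply: fock_norm_le_means => // r r0.
    by rewrite !integral_mean_cst // normc1 -EFinM mulVf // gt_eqF.
  rewrite -[leRHS]mule1; apply: lee_wpmul2l => //.
  by rewrite lee_fin ltW.
have dm0 : 0 < (m - 1) / 2 * c by rewrite mulr_gt0 // divr_gt0 // subr_gt0.
have big : \forall n \near \oo, (normc y + c) / ((m - 1) / 2 * c) < n%:R.
  exact: nbhs_infty_gtr.
have /filter_ex[n [bn gn]] : \forall n \near \oo,
    normc ((avg n)%:C - y) * nu <= 1 /\
    (normc y + c) / ((m - 1) / 2 * c) < n%:R.
  by near=> n; split; near: n.
move: gn; rewrite ltr_pdivrMr // => gn.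
have n0 : 0 < n%:R :> R.
  rewrite -(pmulr_lgt0 _ dm0); apply: le_lt_trans gn.
  by rewrite addr_ge0 ?normc_ge0 // ltW.
have avg_ge : n%:R * ((m - 1) / 2 * c) <= avg n.
  rewrite /avg ler_pdivlMl // -mulr_suml mulrCA -mulrA.
  have := ler_wpM2r (ltW c0) (power_sum_ge n (ltW m_gt1)).
  by rewrite expr2; lra.
have h1 := normc_sub_ge (avg n)%:C y; rewrite normc_real in h1.
have h2 := ler_norm (avg n).
have h3 : c < normc ((avg n)%:C - y) by lra.
by have := ltr_pM2r nu0 c (normc ((avg n)%:C - y)); rewrite h3 c_nu ltNge bn.
Unshelve. all: by end_near. Qed.

End MeanErgodicity.

Theorem theorem9 (R : realType)
    (mu : {measure set (measurableTypeR R) -> \bar R})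
    (phi : R -> R) (p q : \bar R)
    (hmu : mu `]0%R, 1%R]%classic = 0%E)
    (hphi : weight q phi) (hC : class_C phi)
    (hp : (1 <= p)%E) (hq : (1 <= q)%E) :
  hausdorff_uniformly_mean_ergodic p q phi mu <->
  (\int[mu]_(t in `]1%R, +oo[) (t^-1)%:E <= 1)%E.
Proof.
split; first exact: mass_le1_of_hausdorff_ergodic.
exact: hausdorff_ergodic_of_mass_le1.
Qed.
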